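(* Let $\mu$ and $\nu$ be probability measures on $\mathbb{R}^d$ and let $X\sim\mu$, $Y\sim\nu$. Suppose condition $\mathbf{E}(\beta)$ holds for some $\beta>0$ and condition $\mathbf{M}(n)$ holds for some $n\in\{0,1,2,\dots\}$. Then $$\lim_{t\to\infty}t^{n+1}\chi^2(\mu*\rho_t,\nu*\rho_t)=\sum_{\alpha\in[n+1]}\frac{1}{\alpha!}\big|\mathbb{E}X^\alpha-\mathbb{E}Y^\alpha\big|^2,$$ $$\lim_{t\to\infty}t^{n+1}\,\mathrm{D}_{\mathrm{KL}}(\mu*\rho_t\,\|\,\nu*\rho_t)=\frac12\sum_{\alpha\in[n+1]}\frac{1}{\alpha!}\big|\mathbb{E}X^\alpha-\mathbb{E}Y^\alpha\big|^2.$$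
   Context: For $t>0$, $\rho_t(x)=(2\pi t)^{-d/2}e^{-|x|^2/(2t)}$, $x\in\mathbb{R}^d$, is the centered Gaussian density with covariance $t\,\mathrm{Id}$, and $\mu*\rho_t$ denotes convolution (identified with its Lebesgue density). For probability measures with Lebesgue densities (denoted by the same symbols), $\chi^2(\mu,\nu)=\int\frac{(\mu-\nu)^2}{\nu}\,dx$ and $\mathrm{D}_{\mathrm{KL}}(\mu\|\nu)=\int\log\big(\frac{\mu}{\nu}\big)\mu\,dx$. Multi-index notation: for $\alpha\in\mathbb{N}^d$ ($\mathbb{N}$ includes $0$) and $y\in\mathbb{R}^d$, $y^\alpha=\prod_i y_i^{\alpha_i}$, $\alpha!=\prod_i\alpha_i!$, and $[j]=\{\alpha\in\mathbb{N}^d:\sum_i\alpha_i=j\}$. Condition $\mathbf{E}(\beta)$: $\mathbb{E}e^{\beta|X-\mathbb{E}X|^2}<\infty$ and $\mathbb{E}e^{\beta|Y-\mathbb{E}Y|^2}<\infty$. Condition $\mathbf{M}(n)$: $n$ is the largest nonnegative integer such that $\mathbb{E}X^\alpha=\mathbb{E}Y^\alpha$ for all $\alpha\in[k]$ and all $k\le n$; i.e. all moments of order at most $n$ match, but $\mathbb{E}X^\alpha\ne\mathbb{E}Y^\alpha$ for some $\alpha\in[n+1]$. *)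

(* Defs.v *)
From HB Require Import structures.
From mathcomp Require Import all_boot all_order all_algebra.
From mathcomp Require Import all_classical all_reals all_analysis.

Set Implicit Arguments.
Unset Strict Implicit.
Unset Printing Implicit Defensive.

Import Order.TTheory GRing.Theory Num.Theory.
Import numFieldNormedType.Exports.

Local Open Scope classical_set_scope.
Local Open Scope ring_scope.

(** R^d is the type [d.-tuple R], with the library's product of the Borel
    sigma-algebras. *)

Definition tuple_cons (R : realType) (d : nat) (p : R * d.-tuple R) :
  d.+1.-tuple R := [tuple of p.1 :: p.2].

Lemma measurable_tuple_cons (R : realType) (d : nat) :
  measurable_fun [set: R * d.-tuple R] (@tuple_cons R d).
Proof. exact: measurable_cons measurable_fst measurable_snd. Qed.

Section lebesgue_step.
Local Open Scope ereal_scope.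
Context (R : realType) (d : nat)
  (mu : {sigma_finite_measure set (d.-tuple R) -> \bar R}).

Definition lebesgue_step : set (d.+1.-tuple R) -> \bar R :=
  pushforward (@lebesgue_measure R \x mu) (@tuple_cons R d).

Let lebesgue_step0 : lebesgue_step set0 = 0.
Proof. by rewrite /lebesgue_step /pushforward preimage_set0 measure0. Qed.

Let lebesgue_step_ge0 A : 0 <= lebesgue_step A.
Proof. by rewrite /lebesgue_step /pushforward measure_ge0. Qed.

Let lebesgue_step_sigma_additive : semi_sigma_additive lebesgue_step.
Proof.
move=> F mF tF mUF; rewrite /lebesgue_step /pushforward preimage_bigcup.
have mf A : measurable A -> measurable (@tuple_cons R d @^-1` A).
  move=> mA; rewrite -[X in measurable X]setTI.
  exact: measurable_tuple_cons.
apply: measure_semi_sigma_additive => //.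
- by move=> n; apply: mf.
- apply/trivIsetP => /= i j _ _ ij; rewrite -preimage_setI.
  by move/trivIsetP : tF => /(_ i j) ->//; rewrite preimage_set0.
- by rewrite -preimage_bigcup; apply: mf.
Qed.

HB.instance Definition _ := isMeasure.Build _ _ _ lebesgue_step
  lebesgue_step0 lebesgue_step_ge0 lebesgue_step_sigma_additive.

(** Proved directly: the canonical sigma-finite structure of [\x] is the one
    declared for a product of subprobabilities. *)
Let lebesgue_step_sigma_finite : sigma_finite setT lebesgue_step.
Proof.
have /sigma_finiteP[F [TF ndF Foo]] := sigma_finiteT (@lebesgue_measure R).
have /sigma_finiteP[G [TG ndG Goo]] := sigma_finiteT mu.
pose tl (x : d.+1.-tuple R) : d.-tuple R := [tuple of behead x].
exists (fun k => [set x | F k (thead x)] `&` [set x | G k (tl x)]).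
  apply/esym; rewrite -subTset => x _.
  have [i _ Fi] : (\bigcup_k F k) (thead x) by rewrite -TF.
  have [j _ Gj] : (\bigcup_k G k) (tl x) by rewrite -TG.
  exists (maxn i j) => //; split => /=.
  - by move: Fi; exact/subsetPset/ndF/leq_maxl.
  - by move: Gj; exact/subsetPset/ndG/leq_maxr.
move=> k; have [mFk Fk] := Foo k; have [mGk Gk] := Goo k; split.
  apply: measurableI; rewrite -[X in measurable X]setTI.
    exact: (@measurable_tnth _ R _ ord0).
  exact: measurable_behead.
rewrite /lebesgue_step /pushforward (_ : _ @^-1` _ = F k `*` G k).
  by rewrite product_measure1E// lte_mul_pinfty// ge0_fin_numE.
apply/seteqP; split=> -[x v]; rewrite /= theadE;
  by rewrite (_ : tl _ = v)//; exact: val_inj.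
Qed.

HB.instance Definition _ := Measure_isSigmaFinite.Build _ _ _ lebesgue_step
  lebesgue_step_sigma_finite.

End lebesgue_step.

(** Lebesgue measure on R^d: the point mass for d = 0, and the image of the
    product of one- and d-dimensional Lebesgue measure for d + 1. *)
Fixpoint lebesgue_tuple (R : realType) (d : nat) :
    {sigma_finite_measure set (d.-tuple R) -> \bar R} :=
  match d with
  | 0 => dirac ([tuple] : 0.-tuple R)
  | d'.+1 => lebesgue_step (lebesgue_tuple R d')
  end.

Lemma lebesgue_tuple_box (R : realType) (d : nat) (A : 'I_d -> set R) :
  (forall i, measurable (A i)) ->
  (lebesgue_tuple R d [set x | forall i, A i (tnth x i)] =
   \prod_(i < d) lebesgue_measure (A i))%E.
Proof.
elim: d A => [|d IH] A mA /=.
  by rewrite big_ord0 diracE mem_set//= => -[].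
rewrite big_ord_recl -(IH (fun i => A (lift ord0 i)))//.
have mB : measurable [set x : d.-tuple R | forall i, A (lift ord0 i) (tnth x i)].
  rewrite (_ : mkset _ = \big[setI/setT]_(i < d)
      ((@tnth _ R ^~ i) @^-1` A (lift ord0 i))).
    apply: bigsetI_measurable => i _; rewrite -[X in measurable X]setTI.
    exact: measurable_tnth.
  rewrite -bigcap_seq; apply/seteqP; split => [x /= h i _|x /= h i]; first exact: h.
  by apply: h => /=; rewrite mem_index_enum.
rewrite -product_measure1E//; last exact: mA.
rewrite /lebesgue_step /pushforward.
apply: (congr1 (@lebesgue_measure R \x lebesgue_tuple R d)%E).
apply/seteqP; split => [[x v] /= h|[x v] /= [h0 h] i].
  split=> [|i]; first exact: (h ord0).
  by have := h (lift ord0 i); rewrite tnthS.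
by case: (unliftP ord0 i) => [j ->|->]; rewrite ?tnthS.
Qed.

Section euclidean.
Context (R : realType) (d : nat).
Implicit Types (x y : d.-tuple R) (a : d.-tuple nat).

Definition vsub x y : d.-tuple R := [tuple tnth x i - tnth y i | i < d].

Definition sqnorm x : R := \sum_(i < d) tnth x i ^+ 2.

Definition monomial x a : R := \prod_(i < d) tnth x i ^+ tnth a i.

End euclidean.

Definition mfact (d : nat) (a : d.-tuple nat) : nat := (\prod_(i < d) (tnth a i)`!)%N.

Definition multi_indices (d j : nat) : set (d.-tuple nat) :=
  [set a | (\sum_(i < d) tnth a i = j)%N].
Arguments multi_indices : clear implicits.

(** [\sum_(a \in A)] is 0 when the summand is nonzero infinitely often on A. *)
Lemma finite_multi_indices (d j : nat) : finite_set (multi_indices d j).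
Proof.
apply: (@sub_finite_set _ _
  ((fun t : d.-tuple 'I_j.+1 => map_tuple (@nat_of_ord j.+1) t) @` setT)).
  move=> a /= aj; exists (map_tuple inord a) => //.
  apply: eq_from_tnth => i; rewrite !tnth_map inordK// ltnS -aj.
  by rewrite (bigD1 i)//= leq_addr.
exact/finite_image/finite_finset.
Qed.

(** [fine] makes a divergent expectation 0. This is harmless under [cond_E]:
    if E exp (beta |X - c|^2) is finite for one vector c and one beta > 0, then
    every moment of X, in particular its mean, is absolutely convergent. *)
Section random_vector.
Context (R : realType) (d : nat) (dO : measure_display) (O : measurableType dO)
  (P : probability O R) (X : {RV P >-> d.-tuple R}).

Definition has_law (mu : probability (d.-tuple R) R) : Prop :=
  forall A, measurable A -> distribution P X A = mu A.

Definition mean : d.-tuple R := [tuple fine 'E_P[fun w => tnth (X w) i] | i < d].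

Definition moment (a : d.-tuple nat) : R :=
  fine 'E_P[fun w => monomial (X w) a].

Definition exp_sq_integrable (beta : R) : Prop :=
  ('E_P[fun w => expR (beta * sqnorm (vsub (X w) mean))] < +oo)%E.

End random_vector.

Section conditions.
Context (R : realType) (d : nat).
Context (d1 d2 : measure_display) (O1 : measurableType d1)
  (O2 : measurableType d2) (P : probability O1 R) (Q : probability O2 R).
Context (X : {RV P >-> d.-tuple R}) (Y : {RV Q >-> d.-tuple R}).

Definition cond_E (beta : R) : Prop :=
  exp_sq_integrable X beta /\ exp_sq_integrable Y beta.

Definition moments_match (n : nat) : Prop :=
  forall k, (k <= n)%N ->
  forall a, multi_indices d k a -> moment X a = moment Y a.

Definition cond_M (n : nat) : Prop :=
  moments_match n /\ forall m, moments_match m -> (m <= n)%N.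

End conditions.

Section divergences.
Context (R : realType) (d : nat).
Implicit Types (t : R) (x : d.-tuple R) (p q : d.-tuple R -> R).

Definition gauss_density t x : R :=
  (2 * pi * t) `^ (- (d%:R / 2)) * expR (- (sqnorm x / (2 * t))).

(** The Lebesgue density of mu * rho_t. *)
Definition gauss_conv (mu : probability (d.-tuple R) R) t x : R :=
  \int[mu]_y gauss_density t (vsub x y).

Definition chi2 p q : \bar R :=
  (\int[lebesgue_tuple R d]_x ((p x - q x) ^+ 2 / q x)%:E)%E.

Definition KL p q : \bar R :=
  (\int[lebesgue_tuple R d]_x (ln (p x / q x) * p x)%:E)%E.

End divergences.

(* Main.v *)
Require Import Defs.
From mathcomp Require Import all_boot all_order all_algebra.
From mathcomp Require Import all_classical all_reals all_analysis.
From mathcomp Require Import measurable_realfun.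
From mathcomp Require Import ring lra.

Set Implicit Arguments.
Unset Strict Implicit.
Unset Printing Implicit Defensive.

Import Order.TTheory GRing.Theory Num.Theory.
Import numFieldNormedType.Exports.

Local Open Scope classical_set_scope.
Local Open Scope ring_scope.

(** Put [s = t^(-1/2)] and [z = s x].  The density of [mu * rho_t] at [x] is
    [rho_t x] times the tilt [f z = E exp (s z.X - s^2 |X|^2 / 2)]; let [g] be
    the tilt of [Y].  With [m = n + 1], matching moments kill every term of
    order below [s^m] in the expansion of [f - g], so that
    [|f - g| = O(s^m exp (eps |z|^2))], while [1 / f], [1 / g] and [(g - 1) / s]
    are [O(exp (eps |z|^2))].  Hence both divergences differ by [O(s^(2m+1))]
    from a multiple (1 for chi^2, 1/2 for KL) of the integral of
    [rho_t (f - g)^2].  That integral is explicit: the integral of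
    [rho_t f g] is [E exp (s^2 X.Y)] for independent [X] and [Y], and the
    multinomial theorem gives its expansion in powers of [s^2]; the leading
    surviving coefficient, at [s^(2m)], is the claimed limit. *)

(** * Elementary inequalities *)

(** In the variable [z] the weight [rho_t] is a standard Gaussian for every [t], so an error bounded
    by [exp (|z|^2 / 4)] integrates to a constant free of [t]. Bounds polynomial in [z] are out of
    reach: for fixed [s] the tilt of a Gaussian law already grows like [exp (c |z|^2)]. The obstacle
    is the denominator. Neither [g] nor [f / g] is uniformly close to 1 for large [z], so no
    expansion in a small ratio is available; the logarithm is handled by an inequality valid on the
    whole half-line, at the price of factors [1 / f] and [1 / g]. At most five exponential weights
    get multiplied, and this decides how small [eps] must be. For KL the integrand also has the
    linear term [f - g], only of order [s^m], which would swamp [s^(2m)]; it disappears exactly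
    because both densities have mass one. The cubic remainder is of order [s^(3m)], hence
    [O(s^(2m+1))] since [m >= 1]. Computing the quadratic term exactly through overlaps means that
    only upper bounds on [|f - g|] are ever needed, and no pointwise limit of [(f - g) / s^m]. *)

Definition exp_poly (R : realType) (m : nat) (u : R) : R :=
  \sum_(k < m) u ^+ k / k`!%:R.

Lemma is_derive_exp_poly (R : realType) (m : nat) (u : R) :
  is_derive u (1 : R) (@exp_poly R m.+1) (exp_poly m u).
Proof.
elim: m u => [|m IH] u.
  have -> : @exp_poly R 1 = cst 1.
    by apply/funext => x; rewrite /exp_poly big_ord1 expr0 fact0 divr1.
  by rewrite /exp_poly big_ord0; exact: is_derive_cst.
have -> : @exp_poly R m.+2 =
    @exp_poly R m.+1 + (m.+1)`!%:R^-1 *: (id : R -> R) ^+ m.+1.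
  apply/funext => x; rewrite /exp_poly big_ord_recr/= !fctE.
  by congr (_ + _); rewrite mulrC.
rewrite [X in is_derive _ _ _ X](_ : _ = exp_poly m u +
    (m.+1)`!%:R^-1 *: (m.+1%:R * u ^+ m *: (1:R))); last first.
  rewrite {1}/exp_poly big_ord_recr/=; congr (_ + _).
  rewrite /GRing.scale/= factS natrM invfM mulr1.
  have m0 : m`!%:R != 0 :> R by rewrite pnatr_eq0 -lt0n fact_gt0.
  have m1 : m.+1%:R != 0 :> R by rewrite pnatr_eq0.
  by rewrite mulrACA mulVf// mul1r mulrC.
apply: is_deriveD; apply: is_deriveZ.
Qed.

(** No order between [a] and [u] is imposed, so that Taylor estimates around 0 or 1 treat both sides
    at once. *)
Lemma MVT_between (R : realType) (f df : R -> R) (a u : R) :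
  (forall x, Num.min a u <= x <= Num.max a u -> is_derive x (1 : R) f (df x)) ->
  exists2 c, Num.min a u <= c <= Num.max a u & f u - f a = df c * (u - a).
Proof.
have main (x y : R) : x <= y ->
    (forall z, x <= z <= y -> is_derive z (1 : R) f (df z)) ->
    exists2 c, x <= c <= y & f y - f x = df c * (y - x).
  move=> xy D.
  have [||c cxy E] := @MVT_segment R f df x y xy.
  - by move=> z; rewrite in_itv/= => /andP[xz zy]; apply: D; rewrite !ltW.
  - apply: derivable_within_continuous => z; rewrite in_itv/= => xzy.
    by have [] := D z xzy.
  - by exists c.
have [au|/ltW ua] := leP a u => D; first exact: main.
have [c cau E] := main _ _ ua D.
by exists c => //; rewrite -opprB E -mulrN opprB.
Qed.

Lemma exp_poly0 (R : realType) (m : nat) : exp_poly m.+1 (0 : R) = 1.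
Proof.
rewrite /exp_poly big_ord_recl big1 ?addr0 ?expr0 ?fact0 ?divr1//.
by move=> i _; rewrite expr0n/= mul0r.
Qed.

(** The remainder of index [m + 1] vanishes at 0 and has the remainder of index [m] as derivative,
    so each use of the mean value theorem gains one factor [|u|]. The factor [1 / m!] is given up;
    only the order matters later. *)
Lemma exp_taylor_le (R : realType) (m : nat) (u : R) :
  `|expR u - exp_poly m u| <= `|u| ^+ m * expR `|u|.
Proof.
elim: m u => [|m IH] u.
  by rewrite /exp_poly big_ord0 subr0 expr0 mul1r ger0_norm ?expR_ge0// ler_expR ler_norm.
have D x : is_derive x (1 : R) (fun y => expR y - exp_poly m.+1 y)
  (expR x - exp_poly m x) by apply: is_deriveB; exact: is_derive_exp_poly.
have [c c0u] := MVT_between (fun x _ => D x) (a := 0) (u := u).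
rewrite subr0.
have cu : `|c| <= `|u|.
  by move: c0u; rewrite minEle maxEle; case: ifP => h /andP[? ?];
    case: (ger0P c); case: (ger0P u) => *; lra.
rewrite exp_poly0 expR0 subrr !subr0 => ->; rewrite normrM mulrC exprS -mulrA ler_wpM2l//.
apply: (le_trans (IH c)); apply: ler_pM; rewrite ?exprn_ge0 ?expR_ge0 ?ler_expR//.
by rewrite lerXn2r// nnegrE.
Qed.

Lemma exp_poly_le (R : realType) (m : nat) (u : R) : 0 <= u ->
  exp_poly m u <= expR u.
Proof.
elim: m u => [|m IH] u u0; first by rewrite /exp_poly big_ord0 expR_ge0.
have D x : is_derive x (1 : R) (fun y => expR y - exp_poly m.+1 y)
  (expR x - exp_poly m x) by apply: is_deriveB; exact: is_derive_exp_poly.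
have [c] := MVT_between (fun x _ => D x) (a := 0) (u := u).
rewrite exp_poly0 expR0 subrr !subr0 min_l// max_r// => /andP[c0 _] E.
by rewrite -subr_ge0 E mulr_ge0// subr_ge0 IH.
Qed.

Lemma norm_exp_poly_le (R : realType) (m : nat) (u : R) :
  `|exp_poly m u| <= expR `|u|.
Proof.
apply: le_trans (exp_poly_le m (normr_ge0 u)).
apply: (le_trans (ler_norm_sum _ _ _)); apply: ler_sum => k _.
by rewrite normrM normrX normfV !normr_nat.
Qed.

(** The left side is a function with value 0 at 1 and derivative [ln c - (c - 1)], and
    [1 - 1/c <= ln c <= c - 1] bounds this derivative by [(c - 1)^2 / c]. For [c] between 1 and [r],
    [1/c] is at most 1 or at most [1/r], whence the factor [1 + 1/r], which keeps the estimate valid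
    down to [r = 0]. *)
Lemma xlnx_taylor (R : realType) (r : R) : 0 < r ->
  `|r * ln r - (r - 1) - (r - 1) ^+ 2 / 2| <= `|r - 1| ^+ 3 * (1 + r^-1).
Proof.
move=> r0.
pose G : R -> R := id * @ln R - (id - cst 1) - 2^-1 *: (id - cst 1) ^+ 2.
have GE x : G x = x * ln x - (x - 1) - (x - 1) ^+ 2 / 2.
  by rewrite /G !fctE mulrC [X in _ - X]mulrC [in X in X - _ - _]mulrC.
have [|c] := @MVT_between R G (fun x => ln x - (x - 1)) 1 r.
  move=> x /andP[x1 _].
  have x0 : 0 < x by apply: lt_le_trans x1; rewrite lt_min ltr01.
  have D1 := is_deriveB (is_derive_id x (1 : R)) (is_derive_cst (1 : R) x 1).
  have D := is_deriveB (is_deriveB (is_deriveM (is_derive_id x 1) (is_derive1_ln x0)) D1)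
    (is_deriveZ 2^-1 (is_deriveX 2 D1)).
  apply: is_derive_eq D _.
  by rewrite /GRing.scale/= !fctE; field; rewrite gt_eqF.
rewrite !GE.
rewrite ln1 !subrr mulr0 expr0n/= mul0r !subr0 => /andP[c1 c2] ->.
have c0 : 0 < c by apply: lt_le_trans c1; rewrite lt_min ltr01.
have lnc : ln c <= c - 1 by have := @le_ln1Dx R (c - 1); rewrite subrKC; apply; lra.
have lncV : 1 - c^-1 <= ln c.
  have ci0 : 0 < c^-1 by rewrite invr_gt0.
  have : -1 < c^-1 - 1 by lra.
  by move/le_ln1Dx; rewrite subrKC lnV ?posrE// => h; lra.
rewrite normrM exprS mulrC -mulrA ler_wpM2l//.
rewrite ler0_norm; last lra.
have ci : `|c - 1| <= `|r - 1|.
  by move: c1 c2; rewrite minEle maxEle; case: ifP => h ? ?;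
    case: (ger0P (c-1)); case: (ger0P (r-1)) => *; lra.
apply: (@le_trans _ _ ((c - 1) ^+ 2 * c^-1)).
  rewrite (_ : _ * _ = c - 1 - (1 - c^-1)); first lra.
  by field; rewrite gt_eqF.
rewrite -[(c - 1) ^+ 2]real_normK ?num_real// ler_pM ?invr_ge0 ?(ltW c0)//.
  by rewrite lerXn2r// nnegrE.
have ? : 0 < r^-1 by rewrite invr_gt0.
move: c1; rewrite minEle; case: ifP => h cc.
  have : c^-1 <= 1 by rewrite invf_le1.
  lra.
have : c^-1 <= r^-1 by rewrite lef_pV2 ?posrE.
lra.
Qed.

(** One constant serves every exponent up to [N]: [S^k <= (1 + S)^N], and [(delta (1 + S))^N / N!]
    is a single term of the exponential series at [delta (1 + S)]. *)
Lemma pow_le_expR (R : realType) (N : nat) (delta : R) : 0 < delta ->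
  exists2 C : R, 0 < C & forall k (S : R), (k <= N)%N -> 0 <= S ->
    S ^+ k <= C * expR (delta * S).
Proof.
move=> d0; exists (N`!%:R * delta ^- N * expR delta).
  by rewrite !mulr_gt0 ?invr_gt0 ?exprn_gt0 ?expR_gt0 ?ltr0n ?fact_gt0.
move=> k S kN S0.
apply: (@le_trans _ _ ((1 + S) ^+ N)).
  apply: (@le_trans _ _ ((1 + S) ^+ k)).
    by rewrite lerXn2r ?nnegrE ?addr_ge0// lerDr.
  by rewrite ler_weXn2l ?lerDl.
have H : (delta * (1 + S)) ^+ N / N`!%:R <= expR (delta * (1 + S)).
  have h : 0 <= delta * (1 + S) by apply: mulr_ge0; [exact: ltW|exact: addr_ge0].
  apply: le_trans (exp_poly_le N.+1 h).
  rewrite /exp_poly big_ord_recr/= lerDr sumr_ge0// => i _.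
  by rewrite divr_ge0 ?exprn_ge0.
move: H; rewrite ler_pdivrMr ?ltr0n ?fact_gt0// exprMn mulrDr mulr1 expRD => H.
rewrite -(ler_pM2l (exprn_gt0 N d0)); apply: (le_trans H).
rewrite le_eqVlt; apply/orP; left; apply/eqP; field; by rewrite expf_neq0 // gt_eqF.
Qed.

(** * Multi-indices *)

Definition dot (R : realType) (d : nat) (x y : d.-tuple R) : R :=
  \sum_(i < d) tnth x i * tnth y i.

Lemma multi_indices_cons (R : realType) (d k : nat) (F : d.+1.-tuple nat -> R) :
  \sum_(a \in multi_indices d.+1 k) F a =
  \sum_(j < k.+1) \sum_(b \in multi_indices d (k - j)) F [tuple of val j :: b].
Proof.
rewrite fsbig_finite; last exact: finite_multi_indices.
rewrite big_seq (partition_big (fun a => inord (thead a) : 'I_k.+1) predT)//=.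
apply: eq_bigr => j _; rewrite -big_seq_cond.
rewrite -big_filter fsbig_seq ?filter_uniq ?finmap.fset_uniq//.
apply: (@reindex_fsbig _ _ _ _ _ (fun b : d.-tuple nat => [tuple of val j :: b])).
have jk : (j <= k)%N by rewrite -ltnS.
split.
- move=> b /= bk; rewrite mem_filter theadE inord_val eqxx/= in_fset_set;
    last exact: finite_multi_indices.
  rewrite inE /multi_indices/= big_ord_recl tnth0.
  under eq_bigr do rewrite tnthS.
  by rewrite bk subnKC.
- by move=> b c _ _ /(congr1 val)/= [] /val_inj.
- move=> a; rewrite /= mem_filter => /andP[/eqP aj].
  rewrite in_fset_set; last exact: finite_multi_indices.
  case/tupleP: a aj => x b; rewrite theadE inE /multi_indices/= big_ord_recl tnth0 => xj.
  under eq_bigr do rewrite tnthS.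
  move=> xb; have xE : x = j by rewrite -xj inordK// ltnS -xb leq_addr.
  exists b; last by apply: val_inj; rewrite /= xE.
  by rewrite /=; apply/eqP; rewrite -(eqn_add2l j) subnKC // -xE; exact/eqP.
Qed.

(** Division by [k!] turns the binomial theorem into a convolution of the terms [x^j / j!], which is
    the splitting of multi-indices by their first entry; hence the induction on [d]. *)
Lemma multinomial (R : realType) (d k : nat) (u : d.-tuple R) :
  (\sum_(i < d) tnth u i) ^+ k / k`!%:R =
  \sum_(a \in multi_indices d k) monomial u a / (mfact a)%:R.
Proof.
elim: d k u => [|d IH] k u.
  rewrite big_ord0; case: k => [|k].
    rewrite (_ : multi_indices 0 0 = [set [tuple]]).
      by rewrite fsbig_set1 /monomial /mfact !big_ord0 expr0 fact0.
    by apply/seteqP; split => [a _|a _]; [rewrite [a]tuple0|rewrite /multi_indices/= big_ord0].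
  rewrite (_ : multi_indices 0 k.+1 = set0) ?fsbig_set0 ?expr0n ?mul0r//.
  by apply/seteqP; split => [a|a//]; rewrite /multi_indices/= big_ord0.
rewrite multi_indices_cons big_ord_recl addrC exprDn mulr_suml.
apply: eq_bigr => j _.
have jk : (j <= k)%N by rewrite -ltnS.
case/tupleP: u => x u; rewrite tnth0.
under [X in X ^+ _]eq_bigr do rewrite tnthS.
transitivity (x ^+ j / j`!%:R * ((\sum_(i < d) tnth u i) ^+ (k - j) / (k - j)`!%:R)).
  rewrite -(bin_fact jk) -mulr_natr !natrM.
  field.
  by rewrite !pnatr_eq0 -!lt0n !fact_gt0 bin_gt0 jk.
rewrite IH mulr_fsumr; apply: eq_fsbigr => b _.
rewrite /monomial /mfact !big_ord_recl !tnth0 natrM invfM.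
under [in RHS]eq_bigr do rewrite !tnthS.
under [X in _ = _ * (_ * (X%:R)^-1)]eq_bigr do rewrite !tnthS.
by rewrite mulrACA.
Qed.

Lemma dot_multinomial (R : realType) (d k : nat) (x y : d.-tuple R) :
  dot x y ^+ k / k`!%:R =
  \sum_(a \in multi_indices d k) monomial x a * monomial y a / (mfact a)%:R.
Proof.
have := multinomial k [tuple tnth x i * tnth y i | i < d].
under eq_bigr do rewrite tnth_mktuple.
move=> ->; apply: eq_fsbigr => a _; congr (_ / _).
by rewrite /monomial -big_split/=; apply: eq_bigr => i _; rewrite tnth_mktuple exprMn.
Qed.

Lemma sqnorm_ge0 (R : realType) (d : nat) (x : d.-tuple R) : 0 <= sqnorm x.
Proof. by apply: sumr_ge0 => i _; exact: sqr_ge0. Qed.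

(** Cruder than Cauchy-Schwarz, but the bound is a sum, so its exponential is a product of a
    function of [x] and a function of [y]. *)
Lemma norm_dot_le (R : realType) (d : nat) (x y : d.-tuple R) :
  `|dot x y| <= sqnorm x + sqnorm y.
Proof.
rewrite /sqnorm -big_split/=; apply: (le_trans (ler_norm_sum _ _ _)).
apply: ler_sum => i _; rewrite ler_norml; nra.
Qed.

Lemma norm_monomial_le (R : realType) (d k : nat) (x : d.-tuple R) a :
  multi_indices d k a -> `|monomial x a| <= (1 + sqnorm x) ^+ k.
Proof.
rewrite /multi_indices/= => <-; rewrite /monomial normr_prod.
apply: (@le_trans _ _ (\prod_(i < d) (1 + sqnorm x) ^+ tnth a i)).
  apply: ler_prod => i _; rewrite normr_ge0/= normrX lerXn2r ?nnegrE ?addr_ge0 ?sqnorm_ge0//.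
  have : tnth x i ^+ 2 <= sqnorm x.
    by rewrite /sqnorm (bigD1 i)//= lerDl sumr_ge0// => j _; exact: sqr_ge0.
  rewrite ler_norml; nra.
by rewrite prodrXr.
Qed.

Definition mindex_incr (d : nat) (i : 'I_d) (a : d.-tuple nat) : d.-tuple nat :=
  [tuple (tnth a j + (j == i))%N | j < d].

Lemma multi_indices_incr (d k : nat) (i : 'I_d) a :
  multi_indices d k a -> multi_indices d k.+1 (mindex_incr i a).
Proof.
rewrite /multi_indices/= => <-.
under eq_bigr do rewrite tnth_mktuple.
rewrite big_split/= -addn1; congr addn.
by rewrite (bigD1 i)//= eqxx big1 // => j /negbTE ->.
Qed.

Lemma monomial_incr (R : realType) (d : nat) (i : 'I_d) (x : d.-tuple R) a :
  monomial x (mindex_incr i a) = monomial x a * tnth x i.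
Proof.
rewrite /monomial; under eq_bigr do rewrite tnth_mktuple exprD.
rewrite big_split/=; congr (_ * _).
by rewrite (bigD1 i)//= eqxx big1 ?mulr1 // => j /negbTE ->.
Qed.

(** * Integration *)

Lemma measurable_sqnorm (R : realType) (d : nat) :
  measurable_fun [set: d.-tuple R] (@sqnorm R d).
Proof.
by apply: measurable_sum => i; apply: measurable_funX; exact: measurable_tnth.
Qed.

Lemma measurable_monomial (R : realType) (d : nat) a :
  measurable_fun [set: d.-tuple R] (fun x => @monomial R d x a).
Proof.
by apply: measurable_prod => i _; apply: measurable_funX; exact: measurable_tnth.
Qed.

Lemma measurable_fun_dot (R : realType) (d : nat) (d1 : measure_display)
    (T : measurableType d1) (f g : T -> d.-tuple R) :
  measurable_fun setT f -> measurable_fun setT g ->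
  measurable_fun setT (fun w => dot (f w) (g w)).
Proof.
move=> mf mg; apply: measurable_sum => i; apply: measurable_funM.
  exact: measurableT_comp (measurable_tnth i) mf.
exact: measurableT_comp (measurable_tnth i) mg.
Qed.

Lemma measurable_fun_vsub (R : realType) (d : nat) (d1 : measure_display)
    (T : measurableType d1) (f g : T -> d.-tuple R) :
  measurable_fun setT f -> measurable_fun setT g ->
  measurable_fun setT (fun w => vsub (f w) (g w)).
Proof.
move=> mf mg; apply/measurable_fun_tnthP => i.
rewrite (_ : _ \o _ = fun w => tnth (f w) i - tnth (g w) i); last first.
  by apply/funext => w /=; rewrite tnth_mktuple.
apply: measurable_funB.
  exact: measurableT_comp (measurable_tnth i) mf.
exact: measurableT_comp (measurable_tnth i) mg.
Qed.

Lemma measurable_fun_gauss_density (R : realType) (d : nat) (t : R)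
    (d1 : measure_display) (T : measurableType d1) (f : T -> d.-tuple R) :
  measurable_fun setT f -> measurable_fun setT (fun w => gauss_density t (f w)).
Proof.
move=> mf; apply: measurable_funM => //.
apply: measurableT_comp => //; apply: measurableT_comp => //.
by apply: measurable_funM => //; exact: measurableT_comp (@measurable_sqnorm R d) mf.
Qed.

Lemma measurable_fun_inv (R : realType) (d1 : measure_display)
    (T : measurableType d1) (f : T -> R) :
  measurable_fun setT f -> (forall w, 0 <= f w) ->
  measurable_fun setT (fun w => (f w)^-1).
Proof.
move=> mf f0; rewrite (_ : (fun w => (f w)^-1) = (fun w => f w `^ (-1))).
  exact: measurableT_comp (measurable_powR _) mf.
by apply/funext => w; rewrite powR_inv1.
Qed.

Lemma gauss_density_gt0 (R : realType) (d : nat) (t : R) (x : d.-tuple R) :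
  0 < t -> 0 < gauss_density t x.
Proof.
move=> t0; apply: mulr_gt0; last exact: expR_gt0.
by apply: powR_gt0; rewrite !mulr_gt0 ?pi_gt0.
Qed.

(** This factorization follows the recursive construction of Lebesgue measure and reduces Gaussian
    integrals to the one-dimensional normal density. *)
Lemma gauss_density_cons (R : realType) (d : nat) (t : R) (x c : R)
    (v w : d.-tuple R) : 0 < t ->
  gauss_density t (vsub [tuple of x :: v] [tuple of c :: w]) =
  normal_pdf c (Num.sqrt t) x * gauss_density t (vsub v w).
Proof.
move=> t0; have st : Num.sqrt t != 0 by rewrite gt_eqF ?sqrtr_gt0.
have pt : 0 < 2 * pi * t by rewrite !mulr_gt0 ?pi_gt0.
rewrite /normal_pdf (negbTE st) /normal_peak /normal_fun sqr_sqrtr ?ltW//.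
rewrite /gauss_density mulrACA; congr (_ * _).
  have -> : - (d.+1%:R / 2) = - (d%:R / 2) + - (2^-1) :> R.
    by rewrite -natr1 mulrDl div1r opprD.
  rewrite powRD; last first.
    by rewrite (gt_eqF pt) implybT.
  rewrite mulrC; congr (_ * _).
  by rewrite powRN powR12_sqrt ?ltW//; congr (Num.sqrt _)^-1; rewrite -mulr_natl; ring.
rewrite -expRD; congr expR.
rewrite /sqnorm big_ord_recl tnth_mktuple !tnth0.
under eq_bigr do rewrite tnth_mktuple !tnthS.
under [in RHS]eq_bigr do rewrite tnth_mktuple.
by rewrite -[t *+ 2]mulr_natl; field; rewrite gt_eqF.
Qed.

Lemma integral_gauss_density (R : realType) (d : nat) (t : R) (c : d.-tuple R) :
  0 < t ->
  (\int[lebesgue_tuple R d]_x (gauss_density t (vsub x c))%:E = 1)%E.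
Proof.
move=> t0; elim: d c => [|d IH] c /=.
  rewrite integral_dirac//; last first.
    apply/measurable_EFinP; apply: measurable_fun_gauss_density.
    exact: measurable_fun_vsub.
  rewrite diracT mul1e /gauss_density mul0r oppr0 powRr0 /sqnorm big_ord0.
  by rewrite mul0r oppr0 expR0 mulr1.
case/tupleP: c => c0 c.
rewrite ge0_integral_pushforward//=; first last.
- by move=> x _; rewrite lee_fin ltW// gauss_density_gt0.
- apply/measurable_EFinP; apply: measurable_fun_gauss_density.
  exact: measurable_fun_vsub.
- exact: measurable_tuple_cons.
rewrite fubini_tonelli1/=; first last.
- by move=> x; rewrite lee_fin ltW// gauss_density_gt0.
- apply/measurable_EFinP; apply: measurable_fun_gauss_density.
  by apply: measurable_fun_vsub => //; exact: measurable_tuple_cons.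
rewrite -(integral_normal_pdf c0 (Num.sqrt t)); apply: eq_integral => x _.
rewrite /fubini_F/=.
under eq_integral => v _ do rewrite /tuple_cons/= gauss_density_cons// EFinM.

rewrite ge0_integralZl_EFin ?normal_pdf_ge0//; first by rewrite IH mule1.
  by move=> y _; rewrite lee_fin ltW// gauss_density_gt0.
apply/measurable_EFinP; apply: measurable_fun_gauss_density.
exact: measurable_fun_vsub.
Qed.

(** The weight [exp (|x|^2 / (4t))] halves the Gaussian exponent, giving [2^(d/2)] times the density
    of variance [2t]. This is the common dominating function of all error terms, and its mass does
    not depend on [t]. *)
Lemma integral_gauss_density_tilt (R : realType) (d : nat) (t : R) : 0 < t ->
  (\int[lebesgue_tuple R d]_x (gauss_density t x * expR (t^-1 * sqnorm x / 4))%:E =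
   (2 `^ (d%:R / 2))%:E)%E.
Proof.
move=> t0; have t20 : 0 < 2 * t by rewrite mulr_gt0.
have E (x : d.-tuple R) : gauss_density t x * expR (t^-1 * sqnorm x / 4) =
    2 `^ (d%:R / 2) * gauss_density (2 * t) (vsub x [tuple 0 | i < d]).
  have -> : vsub x [tuple 0 | i < d] = x.
    by apply: eq_from_tnth => i; rewrite !tnth_mktuple subr0.
  rewrite /gauss_density -mulrA -expRD mulrA; congr (_ * expR _); last first.
    by field; rewrite gt_eqF.
  rewrite (_ : 2 * pi * (2 * t) = 2 * (2 * pi * t)); last by ring.
  rewrite [in RHS]powRM ?mulr_ge0 ?pi_ge0 ?ltW// mulrA -powRD ?subrr ?powRr0 ?mul1r//.
  by rewrite (gt_eqF (ltr0n _ 2)) implybT.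
under eq_integral do rewrite E EFinM.
rewrite ge0_integralZl_EFin ?powR_ge0//; first by rewrite integral_gauss_density ?mule1.
  by move=> y _; rewrite lee_fin ltW// gauss_density_gt0.
apply/measurable_EFinP; apply: measurable_fun_gauss_density.
exact: measurable_fun_vsub.
Qed.

Lemma measurable_fun_Rintegral (R : realType) (d1 d2 : measure_display)
    (T1 : measurableType d1) (T2 : measurableType d2)
    (m : {sigma_finite_measure set T2 -> \bar R}) (k : T1 -> T2 -> R) :
  measurable_fun setT (fun z : T1 * T2 => k z.1 z.2) ->
  (forall x y, 0 <= k x y) ->
  measurable_fun setT (fun x => \int[m]_y k x y).
Proof.
move=> mk k0; apply: measurableT_comp => //.
apply: (@measurable_fun_fubini_tonelli_F _ _ _ _ _ m (fun z => (k z.1 z.2)%:E)).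
  exact/measurable_EFinP.
by move=> z; rewrite lee_fin.
Qed.

Lemma Rintegral_sum (R : realType) (d1 : measure_display) (T : measurableType d1)
    (m : {measure set T -> \bar R}) (I : Type) (s : seq I) (f : I -> T -> R) :
  (forall i, m.-integrable setT (EFin \o f i)) ->
  m.-integrable setT (EFin \o (fun x => \sum_(i <- s) f i x)) /\
  \int[m]_x (\sum_(i <- s) f i x) = \sum_(i <- s) \int[m]_x f i x.
Proof.
move=> fi; elim: s => [|i s [IH1 IH2]].
  split; last by under eq_Rintegral do rewrite big_nil; rewrite big_nil Rintegral_cst ?mul0r.
  under [X in _ \o X]eq_fun do rewrite big_nil; exact: integrable0.
rewrite big_cons -IH2 -RintegralD//; split.
  under [X in _ \o X]eq_fun do rewrite big_cons.
  exact: (integrableD measurableT (fi i) IH1).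
by apply: eq_Rintegral => x _; rewrite big_cons.
Qed.

(** * Sub-Gaussian laws *)

Definition sq_exp (R : realType) (d : nat) (gamma : R) (y : d.-tuple R) : R :=
  expR (gamma * sqnorm y).

Definition subgauss (R : realType) (d : nat) (gamma : R)
    (mu : probability (d.-tuple R) R) : Prop :=
  mu.-integrable setT (EFin \o sq_exp gamma).

Lemma measurable_sq_exp (R : realType) (d : nat) (gamma : R) :
  measurable_fun [set: d.-tuple R] (sq_exp gamma).
Proof.
apply: measurableT_comp => //; apply: measurable_funM => //.
exact: measurable_sqnorm.
Qed.

Lemma subgauss_le (R : realType) (d : nat) (gamma gamma' : R)
    (mu : probability (d.-tuple R) R) :
  gamma' <= gamma -> subgauss gamma mu -> subgauss gamma' mu.
Proof.
move=> gg; apply: le_integrable => //.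
  by apply/measurable_EFinP; exact: measurable_sq_exp.
move=> x _ /=; rewrite lee_fin !ger0_norm ?expR_ge0// ler_expR.
by rewrite ler_wpM2r// sqnorm_ge0.
Qed.

(** Estimates on tilts and overlaps come from this domination: [C] absorbs whatever depends on the
    scale and on the other vector, leaving a fixed exponential moment. *)
Lemma subgauss_dominated (R : realType) (d : nat) (gamma C : R)
    (mu : probability (d.-tuple R) R) (h : d.-tuple R -> R) :
  subgauss gamma mu -> measurable_fun setT h ->
  (forall y, `|h y| <= C * sq_exp gamma y) ->
  mu.-integrable setT (EFin \o h) /\
  `|\int[mu]_y h y| <= C * \int[mu]_y sq_exp gamma y.
Proof.
move=> sg mh hC.
have iC : mu.-integrable setT (EFin \o (fun y => C * sq_exp gamma y)).
  exact: (integrableZl measurableT C sg).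
have ih : mu.-integrable setT (EFin \o h).
  apply: le_integrable iC => //; first exact/measurable_EFinP.
  move=> y _ /=; rewrite lee_fin; apply: le_trans (hC y) _; exact: ler_norm.
split => //; rewrite -RintegralZl//.
apply: (le_trans (le_normr_Rintegral _ ih)) => //.
apply: le_Rintegral => //; exact: (integrable_norm ih).
Qed.

Section transfer.
Context (R : realType) (d : nat) (dO : measure_display) (O : measurableType dO)
  (P : probability O R) (X : {RV P >-> d.-tuple R})
  (mu : probability (d.-tuple R) R).
Hypothesis hX : has_law X mu.

Lemma has_law_integral (f : d.-tuple R -> \bar R) : 
  (\int[distribution P X]_y f y = \int[mu]_y f y)%E.
Proof. by apply: eq_measure_integral => A mA _; exact: hX. Qed.

(** Removing the centering costs half of [beta]: [|y|^2 / 2 <= |y - c|^2 + |c|^2], and the factor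
    [exp (beta |c|^2)] is a constant. *)
Lemma exp_sq_integrable_subgauss (beta : R) : 0 < beta ->
  exp_sq_integrable X beta -> subgauss (beta / 2) mu.
Proof.
move=> b0; rewrite /exp_sq_integrable unlock => hE.
have m1 : measurable_fun setT
    (fun y : d.-tuple R => expR (beta * sqnorm (vsub y (mean X)))).
  apply: measurableT_comp => //; apply: measurable_funM => //.
  apply: measurableT_comp (@measurable_sqnorm R d) _.
  exact: measurable_fun_vsub.
have i1 : mu.-integrable setT
    (EFin \o (fun y => expR (beta * sqnorm (vsub y (mean X))))).
  apply/integrableP; split; first exact/measurable_EFinP.
  under eq_integral do rewrite /= ger0_norm ?expR_ge0//.
  rewrite -has_law_integral ge0_integral_distribution//; exact/measurable_EFinP.
have i2 := integrableZl measurableT (expR (beta * sqnorm (mean X))) i1.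
apply: le_integrable i2 => //.
  by apply/measurable_EFinP; exact: measurable_sq_exp.
move=> y _ /=; rewrite lee_fin !ger0_norm ?mulr_ge0 ?expR_ge0//.
rewrite -expRD ler_expR -mulrDr -mulrA ler_pM2l// mulrC ler_pdivrMr//.
rewrite /sqnorm -big_split/= mulr_suml; apply: ler_sum => i _.
rewrite /vsub -/(vsub _ _) (tnth_mktuple (fun i => tnth y i - tnth (mean X) i)).
(* The difference of the two sides is half of this square. *)
have := sqr_ge0 (tnth y i - 2 * tnth (mean X) i); nra.
Qed.

Lemma moment_Rintegral (a : d.-tuple nat) :
  mu.-integrable setT (EFin \o (fun y => monomial y a)) ->
  moment X a = \int[mu]_y monomial y a.
Proof.
move=> ia; rewrite /moment unlock /Rintegral; congr fine.
rewrite -has_law_integral integral_distribution//.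
  by apply/measurable_EFinP; exact: measurable_monomial.
have : (distribution P X).-integrable setT (EFin \o (fun y => monomial y a)).
  move/integrableP : ia => [mm ltm]; apply/integrableP; split => //.
  by rewrite has_law_integral.
move/integrableP => [mm ltm].
apply/integrableP; split.
  by apply: measurableT_comp => //; exact: measurable_funP.
move: ltm; rewrite ge0_integral_distribution//.
exact: measurableT_comp.
Qed.

End transfer.

Lemma subgauss_poly (R : realType) (d : nat) (gamma C : R) (N : nat)
    (mu : probability (d.-tuple R) R) (h : d.-tuple R -> R) :
  0 < gamma -> subgauss gamma mu -> measurable_fun setT h -> 0 <= C ->
  (forall y, `|h y| <= C * (1 + sqnorm y) ^+ N) ->
  mu.-integrable setT (EFin \o h).
Proof.
move=> g0 sg mh C0 hC; have [K K0 KN] := pow_le_expR N g0.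
apply: (proj1 (@subgauss_dominated _ _ gamma (C * (K * expR gamma)) _ _ sg mh _)) => y.
apply: (le_trans (hC y)); rewrite -mulrA ler_wpM2l//.
rewrite /sq_exp -mulrA -expRD.
have -> : gamma + gamma * sqnorm y = gamma * (1 + sqnorm y) by ring.
apply: KN => //.
by rewrite addr_ge0// sqnorm_ge0.
Qed.

Section moment_match.
Context (R : realType) (d : nat) (gamma : R) (mu nu : probability (d.-tuple R) R).
Hypothesis g0 : 0 < gamma.
Hypothesis (smu : subgauss gamma mu) (snu : subgauss gamma nu).

Lemma integrable_mixed_monomial (lam : probability (d.-tuple R) R)
    (k i j : nat) a z : subgauss gamma lam -> multi_indices d k a ->
  lam.-integrable setT
    (EFin \o (fun y => monomial y a * dot z y ^+ i * sqnorm y ^+ j)).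
Proof.
move=> sl ak; apply: (@subgauss_poly _ _ gamma ((1 + sqnorm z) ^+ i) (k + i + j)) => //.
- apply: measurable_funM; last by apply: measurable_funX; exact: measurable_sqnorm.
  apply: measurable_funM; first exact: measurable_monomial.
  by apply: measurable_funX; exact: measurable_fun_dot.
- by rewrite exprn_ge0// addr_ge0// sqnorm_ge0.
move=> y; have q0 := sqnorm_ge0 y; have z0 := sqnorm_ge0 z.
rewrite !normrM !exprD !mulrA; apply: ler_pM; rewrite ?mulr_ge0 ?normr_ge0//.
  rewrite [X in _ <= X * _]mulrC -mulrA -exprMn; apply: ler_pM => //.
    exact: norm_monomial_le.
  rewrite normrX lerXn2r ?nnegrE ?mulr_ge0 ?addr_ge0//.
  apply: (le_trans (norm_dot_le _ _)); nra.
by rewrite normrX lerXn2r ?nnegrE ?addr_ge0// ger0_norm// lerDr.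
Qed.

(** The integrand is a homogeneous polynomial in [y] of degree [k + i + 2 j], so its integral is a
    combination of moments of that order. The factor [monomial y a] makes the induction work:
    coordinates are pulled one by one out of [dot z y], and in pairs out of [sqnorm y], and moved
    into [a]. *)
Lemma mixed_monomial_match (m : nat) z :
  (forall k, (k < m)%N -> forall a, multi_indices d k a ->
    \int[mu]_y monomial y a = \int[nu]_y monomial y a) ->
  forall i j k a, multi_indices d k a -> (k + i + j.*2 < m)%N ->
  \int[mu]_y (monomial y a * dot z y ^+ i * sqnorm y ^+ j) =
  \int[nu]_y (monomial y a * dot z y ^+ i * sqnorm y ^+ j).
Proof.
move=> match_m; elim=> [|i IHi] j.
  elim: j => [|j IHj] k a ak km.
    under eq_Rintegral do rewrite !expr0 !mulr1.
    under [RHS]eq_Rintegral do rewrite !expr0 !mulr1.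
    by apply: match_m ak; rewrite !addn0 in km.
  have E lam : subgauss gamma lam ->
      \int[lam]_y (monomial y a * dot z y ^+ 0 * sqnorm y ^+ j.+1) =
      \sum_(l < d) \int[lam]_y
        (monomial y (mindex_incr l (mindex_incr l a)) * dot z y ^+ 0 * sqnorm y ^+ j).
    move=> sl; rewrite -(proj2 (Rintegral_sum _ _)); last first.
      by move=> l; apply: integrable_mixed_monomial.
    apply: eq_Rintegral => y _; rewrite exprSr !expr0 !mulr1 mulrA /sqnorm mulr_sumr.
    by apply: eq_bigr => l _; rewrite !monomial_incr; ring.
  rewrite !E//; apply: eq_bigr => l _; apply: (IHj k.+2).
    by exact: (multi_indices_incr _ (multi_indices_incr _ ak)).
  by move: km; rewrite doubleS !addnS !addn0 !addSn.
move=> k a ak km.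
have E lam : subgauss gamma lam ->
    \int[lam]_y (monomial y a * dot z y ^+ i.+1 * sqnorm y ^+ j) =
    \sum_(l < d) tnth z l * \int[lam]_y
      (monomial y (mindex_incr l a) * dot z y ^+ i * sqnorm y ^+ j).
  move=> sl.
  have il l := integrable_mixed_monomial i j z sl (multi_indices_incr l ak).
  under [RHS]eq_bigr do rewrite -RintegralZl//.
  rewrite -(proj2 (Rintegral_sum _ _)); last first.
    by move=> l; exact: (integrableZl measurableT (tnth z l) (il l)).
  apply: eq_Rintegral => y _; rewrite exprS {1}/dot mulr_suml mulr_sumr mulr_suml.
  by apply: eq_bigr => l _; rewrite !monomial_incr; ring.
rewrite !E//; apply: eq_bigr => l _; congr (_ * _); apply: (IHi _ k.+1).
  exact: multi_indices_incr.
by move: km; rewrite !addnS !addSn.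
Qed.

End moment_match.

(** * Tilted laws *)

Definition tilt_kernel (R : realType) (d : nat) (s : R) (z y : d.-tuple R) : R :=
  expR (s * dot z y - s ^+ 2 / 2 * sqnorm y).

Definition tilt (R : realType) (d : nat) (s : R)
    (mu : probability (d.-tuple R) R) (z : d.-tuple R) : R :=
  \int[mu]_y tilt_kernel s z y.

Lemma sq_exp_ge1 (R : realType) (d : nat) (gamma : R) (y : d.-tuple R) :
  0 <= gamma -> 1 <= sq_exp gamma y.
Proof.
move=> g0; rewrite /sq_exp -[X in X <= _]expR0 ler_expR.
by rewrite mulr_ge0// sqnorm_ge0.
Qed.

Lemma sq_exp_le (R : realType) (d : nat) (gamma gamma' : R) (y : d.-tuple R) :
  gamma <= gamma' -> sq_exp gamma y <= sq_exp gamma' y.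
Proof. by move=> gg; rewrite ler_expR ler_wpM2r// sqnorm_ge0. Qed.

Lemma Rintegral_probability_cst (R : realType) (d : nat)
    (mu : probability (d.-tuple R) R) (c : R) :
  \int[mu]_y cst c y = c.
Proof.
rewrite Rintegral_cst//.
have E : fine (mu setT) = 1 :> R by exact: (congr1 fine (probability_setT mu)).
by rewrite [X in _ * X]E mulr1.
Qed.

Lemma Rintegral_sq_exp_ge1 (R : realType) (d : nat) (gamma : R)
    (mu : probability (d.-tuple R) R) :
  0 <= gamma -> subgauss gamma mu -> 1 <= \int[mu]_y sq_exp gamma y.
Proof.
move=> g0 sg.
have i1 : mu.-integrable setT (EFin \o cst (1 : R)).
  exact: finite_measure_integrable_cst.
have -> : (1 : R) = \int[mu]_y cst 1 y.
  by rewrite Rintegral_probability_cst.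
by apply: le_Rintegral => // y _; exact: sq_exp_ge1.
Qed.

Section tilt.
Context (R : realType) (d : nat) (delta : R).
Hypothesis d0 : 0 < delta.
Implicit Types (mu nu : probability (d.-tuple R) R) (s : R) (z y : d.-tuple R).

Let S z y := sqnorm z + sqnorm y.

Let S_ge0 z y : 0 <= S z y. Proof. by rewrite addr_ge0 ?sqnorm_ge0. Qed.

Lemma measurable_tilt_kernel s z : measurable_fun setT (tilt_kernel s z).
Proof.
apply: measurableT_comp => //; apply: measurable_funB.
  by apply: measurable_funM => //; exact: measurable_fun_dot.
by apply: measurable_funM => //; exact: measurable_sqnorm.
Qed.

Lemma expR_sum_sqnorm gamma z y :
  expR (gamma * (sqnorm z + sqnorm y)) = sq_exp gamma z * sq_exp gamma y.
Proof. by rewrite mulrDr expRD. Qed.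

(** Here [s <= 1] gives [s^2 / 2 <= s], so each half of the exponent costs [s S], and [2 s <= delta]
    makes the total at most [delta S]. The first two bounds keep the power of [s], the third serves
    inside exponentials. *)
Lemma exponent_bounds s z y : 0 <= s <= 1 -> 2 * s <= delta ->
  [/\ `|s * dot z y| <= s * S z y, `|- (s ^+ 2 / 2 * sqnorm y)| <= s * S z y &
   `|s * dot z y| + `|- (s ^+ 2 / 2 * sqnorm y)| <= delta * S z y].
Proof.
move=> /andP[s0 s1] sd.
have h1 : `|s * dot z y| <= s * S z y.
  by rewrite normrM ger0_norm// ler_wpM2l// norm_dot_le.
have h2 : `|- (s ^+ 2 / 2 * sqnorm y)| <= s * S z y.
  rewrite normrN ger0_norm; last by rewrite !mulr_ge0 ?sqnorm_ge0// sqr_ge0.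
  apply: ler_pM; rewrite ?sqnorm_ge0 ?mulr_ge0 ?sqr_ge0//; first nra.
  by rewrite /S lerDr sqnorm_ge0.
split => //; apply: (le_trans (lerD h1 h2)); have := S_ge0 z y; nra.
Qed.

Lemma tilt_kernel_bounds s z y : 0 <= s <= 1 -> 2 * s <= delta ->
  tilt_kernel s z y <= sq_exp delta z * sq_exp delta y /\
  (tilt_kernel s z y)^-1 <= sq_exp delta z * sq_exp delta y.
Proof.
move=> s01 sd; have [_ _ h] := exponent_bounds z y s01 sd.
rewrite -expR_sum_sqnorm /tilt_kernel -expRN !ler_expR; split.
  by apply: le_trans h; apply: lerD; exact: ler_norm.
apply: le_trans h; rewrite opprB addrC -[X in _ + X]opprK.
apply: lerD; first by rewrite -normrN ler_norm.
by rewrite opprK -normrN opprK ler_norm.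
Qed.

Lemma integrable_tilt_kernel mu s z : subgauss delta mu ->
  0 <= s <= 1 -> 2 * s <= delta ->
  mu.-integrable setT (EFin \o tilt_kernel s z).
Proof.
move=> sg s01 sd.
apply: (proj1 (@subgauss_dominated _ _ delta (sq_exp delta z) _ _ sg _ _)).
  exact: measurable_tilt_kernel.
move=> y; rewrite ger0_norm ?expR_ge0//.
by have [] := tilt_kernel_bounds z y s01 sd.
Qed.

(* For every [l], [e^w >= 2 l - l^2 e^-w]; integrating and choosing
   [l = 1 / E e^-w] bounds [E e^w] from below. *)
Lemma tilt_gt0_inv_le mu s z : subgauss delta mu ->
  0 <= s <= 1 -> 2 * s <= delta ->
  0 < tilt s mu z /\
  (tilt s mu z)^-1 <= (\int[mu]_y sq_exp delta y) * sq_exp delta z.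
Proof.
move=> sg s01 sd; set M := \int[mu]_y _.
have M0 : 0 < M by apply: lt_le_trans (Rintegral_sq_exp_ge1 _ sg) => //; exact: ltW.
have B0 : 0 < M * sq_exp delta z by rewrite mulr_gt0 ?expR_gt0.
suff H : (M * sq_exp delta z)^-1 <= tilt s mu z.
  have t0 : 0 < tilt s mu z by apply: lt_le_trans H; rewrite invr_gt0.
  by split => //; rewrite -[leRHS]invrK lef_pV2 ?posrE ?invr_gt0.
set l := (_ * _)^-1.
have i1 : mu.-integrable setT (EFin \o cst (2 * l)).
  exact: finite_measure_integrable_cst.
have i2 : mu.-integrable setT (EFin \o (fun y => l ^+ 2 * sq_exp delta z * sq_exp delta y)).
  exact: (integrableZl measurableT _ sg).
have -> : l = \int[mu]_y (cst (2 * l) y - l ^+ 2 * sq_exp delta z * sq_exp delta y).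
  rewrite RintegralB// Rintegral_probability_cst RintegralZl//.
  by rewrite -/M /l; field; rewrite !gt_eqF// expR_gt0.
apply: le_Rintegral => //.
- exact: (integrableB measurableT i1 i2).
- exact: integrable_tilt_kernel.
move=> y _ /=.
have [_ Kinv] := tilt_kernel_bounds z y s01 sd.
have K0 : 0 < tilt_kernel s z y by exact: expR_gt0.
have l2 : 0 <= l ^+ 2 by exact: sqr_ge0.
rewrite -mulrA; apply: (@le_trans _ _ (2 * l - l ^+ 2 * (tilt_kernel s z y)^-1)).
  by rewrite lerD2l lerN2 ler_wpM2l.
rewrite -(ler_pM2r K0) mulrBl -mulrA -[l ^+ 2 * _ * _]mulrA mulVf ?gt_eqF// mulr1.
have := sqr_ge0 (l - tilt_kernel s z y); nra.
Qed.

(** From [|e^w - 1| <= |w| e^|w|] with [|w| <= 2 s S]. The stray factor [S] is absorbed in a second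
    [exp (delta S)], which is why the exponent becomes [2 delta]. This estimate supplies the extra
    power of [s] when [1 / g] is replaced by 1. *)
Lemma tilt_sub1_le mu : subgauss (2 * delta) mu ->
  exists2 C : R, 0 < C & forall s z, 0 <= s <= 1 -> 2 * s <= delta ->
    `|tilt s mu z - 1| <= C * s * sq_exp (2 * delta) z.
Proof.
move=> sg; have [K K0 KN] := pow_le_expR 1 d0.
have sg1 : subgauss delta mu by apply: subgauss_le sg; rewrite ler_peMl ?ler1n ?ltW.
have M1 : 1 <= \int[mu]_y sq_exp (2 * delta) y.
  by apply: Rintegral_sq_exp_ge1 => //; rewrite mulr_ge0 ?ltW.
exists (2 * K * \int[mu]_y sq_exp (2 * delta) y).
  by rewrite !mulr_gt0//; exact: lt_le_trans M1.
move=> s z s01 sd.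
have i1 : mu.-integrable setT (EFin \o cst (1 : R)).
  exact: finite_measure_integrable_cst.
have -> : tilt s mu z - 1 = \int[mu]_y (tilt_kernel s z y - cst 1 y).
  rewrite RintegralB//; last exact: integrable_tilt_kernel.
  by rewrite Rintegral_probability_cst.
have -> : 2 * K * (\int[mu]_y sq_exp (2 * delta) y) * s * sq_exp (2 * delta) z =
    2 * K * s * sq_exp (2 * delta) z * \int[mu]_y sq_exp (2 * delta) y by ring.
apply: (proj2 (subgauss_dominated sg _ _)).
  by apply: measurable_funB => //; exact: measurable_tilt_kernel.
move=> y /=; have [h1 h2 h3] := exponent_bounds z y s01 sd.
set w := s * dot z y - s ^+ 2 / 2 * sqnorm y.
have wS : `|w| <= 2 * (s * S z y).
  by apply: (le_trans (ler_normD _ _)); rewrite [leRHS]mulrDl !mul1r lerD.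
have wd : `|w| <= delta * S z y by exact: le_trans (ler_normD _ _) h3.
have := exp_taylor_le 1 w.
rewrite /exp_poly big_ord1 expr0 fact0 divr1 expr1 => /le_trans; apply.
apply: (@le_trans _ _ (2 * (s * S z y) * expR (delta * S z y))).
  by apply: ler_pM => //; rewrite ?expR_ge0 ?ler_expR.
have KS := KN 1%N (S z y) isT (S_ge0 z y); rewrite expr1 in KS.
have s0 : 0 <= s by case/andP: s01.
have e0 := expR_ge0 (delta * S z y).
have -> : 2 * (s * S z y) * expR (delta * S z y) =
    2 * s * (S z y * expR (delta * S z y)) by ring.
have -> : 2 * K * s * sq_exp (2 * delta) z * sq_exp (2 * delta) y =
    2 * s * (K * (sq_exp (2 * delta) z * sq_exp (2 * delta) y)) by ring.
rewrite ler_wpM2l ?mulr_ge0// -expR_sum_sqnorm -/(S z y).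
apply: (@le_trans _ _ (K * expR (delta * S z y) * expR (delta * S z y))).
  by rewrite ler_wpM2r.
by rewrite -mulrA -expRD ler_wpM2l ?(ltW K0)// ler_expR mulrDl !mul1r mulrDl.
Qed.

Let coef s (i j : nat) : R := s ^+ (i + j.*2) * ((- 2^-1) ^+ j / (i`!%:R * j`!%:R)).

(** The linear and quadratic parts of the exponent are truncated separately, so every term is
    homogeneous in [y], of degree and order in [s] both equal to [i + 2 j]. Indices fill a whole
    square, hence terms of order [m] and more remain and must be bounded later. The monomial with
    zero exponents is 1 and only gives the shape required by [mixed_monomial_match]. *)
Let trunc (m : nat) s z y : R :=
  \sum_(p : 'I_m * 'I_m) coef s p.1 p.2 *
    (monomial y [tuple 0%N | _ < d] * dot z y ^+ p.1 * sqnorm y ^+ p.2).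

Lemma truncE m s z y :
  trunc m s z y = exp_poly m (s * dot z y) * exp_poly m (- (s ^+ 2 / 2 * sqnorm y)).
Proof.
rewrite /exp_poly big_distrlr/= pair_big/=; apply: eq_bigr => -[i j] _ /=.
have -> : monomial y [tuple 0%N | _ < d] = 1.
  by rewrite /monomial big1 // => l _; rewrite tnth_mktuple expr0.
have -> : - (s ^+ 2 / 2 * sqnorm y) = s ^+ 2 * (- 2^-1) * sqnorm y by ring.
rewrite /coef mul1r !exprMn -addnn !exprD; field.
by rewrite !pnatr_eq0 -!lt0n !fact_gt0.
Qed.

Lemma coef_le m s (i j : nat) : 0 <= s <= 1 -> (m <= i + j.*2)%N ->
  `|coef s i j| <= s ^+ m.
Proof.
move=> /andP[s0 s1] mij.
rewrite /coef normrM normrX ger0_norm// -[leRHS]mulr1; apply: ler_pM.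
- by rewrite exprn_ge0.
- exact: normr_ge0.
- exact: ler_wiXn2l.
rewrite normrM normrX normrN !normfV normrM !normr_nat.
have h k : (k`!%:R : R)^-1 <= 1 by rewrite invf_le1 ?ltr0n ?fact_gt0// ler1n fact_gt0.
rewrite invfM -[leRHS]mulr1 ler_pM ?mulr_ge0 ?invr_ge0 ?exprn_ge0//.
  by rewrite exprn_ile1 ?invr_ge0// invf_le1 ?ler1n ?ltr0n.
by rewrite -[leRHS]mulr1 ler_pM ?invr_ge0.
Qed.

Lemma trunc_error m s z y : 0 <= s <= 1 -> 2 * s <= delta ->
  `|tilt_kernel s z y - trunc m s z y| <=
  2 * (s ^+ m * (S z y ^+ m * expR (delta * S z y))).
Proof.
move=> s01 sd; have [hu hv huv] := exponent_bounds z y s01 sd.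
rewrite truncE /tilt_kernel -[s * _ - _]/(s * dot z y + - _) expRD.
set u := s * dot z y in hu huv *; set v := - _ in hv huv *.
(* Replacing one factor at a time leaves a single Taylor remainder in each term; the other factor is
   at most [exp |u|] or [exp |v|]. *)
have -> : expR u * expR v - exp_poly m u * exp_poly m v =
  (expR u - exp_poly m u) * expR v + exp_poly m u * (expR v - exp_poly m v) by ring.
have E := expR_ge0.
have euv : expR `|u| * expR `|v| <= expR (delta * S z y) by rewrite -expRD ler_expR.
have side (w : R) : `|w| <= s * S z y ->
    `|w| ^+ m * (expR `|u| * expR `|v|) <= s ^+ m * (S z y ^+ m * expR (delta * S z y)).
  move=> wS; rewrite mulrA -exprMn; apply: ler_pM => //; rewrite ?mulr_ge0 ?exprn_ge0//.
  by rewrite lerXn2r ?nnegrE ?(le_trans _ wS).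
apply: (le_trans (ler_normD _ _)); rewrite [leRHS]mulrDl !mul1r.
apply: lerD; rewrite normrM.
  apply: (le_trans _ (side _ hu)); rewrite mulrA; apply: ler_pM => //.
    exact: exp_taylor_le.
  by rewrite ger0_norm// ler_expR ler_norm.
apply: (le_trans _ (side _ hv)); rewrite mulrCA; apply: ler_pM => //.
  exact: norm_exp_poly_le.
exact: exp_taylor_le.
Qed.

(** [C] is chosen before the law, so one constant serves both laws; the law enters only through its
    exponential moment. *)
Lemma tilt_trunc_error m : exists2 C : R, 0 < C & forall mu, subgauss (2 * delta) mu ->
  forall s z, 0 <= s <= 1 -> 2 * s <= delta ->
  `|tilt s mu z - \sum_(p : 'I_m * 'I_m) coef s p.1 p.2 *
     \int[mu]_y (monomial y [tuple 0%N | _ < d] * dot z y ^+ p.1 * sqnorm y ^+ p.2)| <=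
   C * s ^+ m * sq_exp (2 * delta) z * \int[mu]_y sq_exp (2 * delta) y.
Proof.
have [K K0 KN] := pow_le_expR m d0.
exists (2 * K); first by rewrite mulr_gt0.
move=> mu sg s z s01 sd.
have sg1 : subgauss delta mu by apply: subgauss_le sg; rewrite ler_peMl ?ler1n ?ltW.
have i0 (p : 'I_m * 'I_m) := integrable_mixed_monomial d0 p.1 p.2 z sg1
  (erefl : multi_indices d _ [tuple 0%N | _ < d]).
have i1 (p : 'I_m * 'I_m) := integrableZl measurableT (coef s p.1 p.2) (i0 p).
under eq_bigr do rewrite -RintegralZl//.
have [i2 <-] := @Rintegral_sum _ _ _ mu _ (index_enum ('I_m * 'I_m)%type) _ i1.
have i3 := integrable_tilt_kernel z sg1 s01 sd.
rewrite -RintegralB//.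
apply: (proj2 (subgauss_dominated sg _ _)).
  apply: measurable_funB; first exact: measurable_tilt_kernel.
  by apply/measurable_EFinP; exact: (measurable_int _ i2).
move=> y; apply: (le_trans (trunc_error m z y s01 sd)).
have s0 : 0 <= s ^+ m by rewrite exprn_ge0//; case/andP: s01.
have -> : 2 * K * s ^+ m * sq_exp (2 * delta) z * sq_exp (2 * delta) y =
    2 * (s ^+ m * (K * (sq_exp (2 * delta) z * sq_exp (2 * delta) y))) by ring.
rewrite ler_wpM2l// ler_wpM2l// -expR_sum_sqnorm -/(S z y).
apply: (@le_trans _ _ (K * expR (delta * S z y) * expR (delta * S z y))).
  by rewrite ler_wpM2r ?expR_ge0// KN.
by rewrite -mulrA -expRD ler_wpM2l ?(ltW K0)// ler_expR mulrDl !mul1r mulrDl.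
Qed.

Lemma tilt_sub_le m mu nu : subgauss (2 * delta) mu -> subgauss (2 * delta) nu ->
  (forall k, (k < m)%N -> forall a, multi_indices d k a ->
    \int[mu]_y monomial y a = \int[nu]_y monomial y a) ->
  exists2 C : R, 0 < C & forall s z, 0 <= s <= 1 -> 2 * s <= delta ->
    `|tilt s mu z - tilt s nu z| <= C * s ^+ m * sq_exp (2 * delta) z.
Proof.
move=> smu snu mm.
have [C C0 HC] := tilt_trunc_error m.
(* A term of the square of indices is bounded by [S^(i+j)] with [i + j <= 2 m]. *)
have [K K0 KN] := pow_le_expR m.*2 d0.
set Mm := \int[mu]_y sq_exp (2 * delta) y; set Mn := \int[nu]_y sq_exp (2 * delta) y.
have d20 : 0 < 2 * delta by rewrite mulr_gt0.
have Mm1 : 1 <= Mm by apply: Rintegral_sq_exp_ge1 => //; exact: ltW.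
have Mn1 : 1 <= Mn by apply: Rintegral_sq_exp_ge1 => //; exact: ltW.
have M0 : 0 < Mm + Mn by lra.
(* [C] pays for the two truncation errors, [m^2 K] for the terms of order at least [m] that survive
   in the difference. *)
exists ((C + (m * m)%:R * K) * (Mm + Mn)).
  by rewrite mulr_gt0// ltr_wpDr// mulr_ge0// ltW.
move=> s z s01 sd.
have s0 : 0 <= s ^+ m by rewrite exprn_ge0//; case/andP: s01.
have q0 := expR_ge0 (2 * delta * sqnorm z); rewrite -/(sq_exp _ _) in q0.
pose I (lam : probability (d.-tuple R) R) (p : 'I_m * 'I_m) : R :=
  \int[lam]_y (monomial y [tuple 0%N | _ < d] * dot z y ^+ p.1 * sqnorm y ^+ p.2).
have bnd lam : subgauss (2 * delta) lam -> forall p,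
    `|I lam p| <= K * sq_exp (2 * delta) z * \int[lam]_y sq_exp (2 * delta) y.
  move=> sl p; have sl1 : subgauss delta lam.
    by apply: subgauss_le sl; rewrite ler_peMl ?ler1n ?ltW.
  have i0 := integrable_mixed_monomial d0 p.1 p.2 z sl1
    (erefl : multi_indices d _ [tuple 0%N | _ < d]).
  apply: (proj2 (subgauss_dominated sl _ _)).
    by apply/measurable_EFinP; exact: (measurable_int _ i0).
  move=> y; rewrite /monomial big1 ?mul1r; last first.
    by move=> l _; rewrite tnth_mktuple expr0.
  rewrite -mulrA -expR_sum_sqnorm -/(S z y).
  apply: (@le_trans _ _ (S z y ^+ (p.1 + p.2))).
    rewrite normrM !normrX exprD; apply: ler_pM => //; rewrite lerXn2r ?nnegrE//.
      exact: norm_dot_le.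
    by rewrite ger0_norm ?sqnorm_ge0// /S lerDr sqnorm_ge0.
  have pm : (p.1 + p.2 <= m.*2)%N by rewrite -addnn leq_add// ltnW.
  apply: (le_trans (KN _ _ pm (S_ge0 z y))).
  rewrite ler_wpM2l ?(ltW K0)// ler_expR ler_wpM2r// ler_peMl ?ler1n ?ltW//.
have HS : `|\sum_(p : 'I_m * 'I_m) coef s p.1 p.2 * I mu p -
      \sum_(p : 'I_m * 'I_m) coef s p.1 p.2 * I nu p| <=
    (m * m)%:R * (s ^+ m * (K * sq_exp (2 * delta) z * (Mm + Mn))).
  rewrite -sumrB; apply: (le_trans (ler_norm_sum _ _ _)).
  have -> : (m * m)%:R = \sum_(p : 'I_m * 'I_m) (1 : R).
    by rewrite sumr_const card_prod !card_ord.
  rewrite mulr_suml; apply: ler_sum => p _; rewrite mul1r -mulrBr.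
  (* Below order [m] the moments agree and the term cancels; otherwise its coefficient is already at
     most [s^m]. *)
  have [pm|pm] := ltnP (p.1 + p.2.*2) m.
    have -> : I mu p = I nu p.
      have mult0 : multi_indices d 0 [tuple 0%N | _ < d].
        by rewrite /multi_indices/= big1 // => l _; rewrite tnth_mktuple.
      exact: (mixed_monomial_match d20 smu snu z mm (i := p.1) (j := p.2) mult0 pm).
    by rewrite subrr mulr0 normr0 !mulr_ge0 ?(ltW K0)// ltW.
  rewrite normrM ler_pM//; first exact: coef_le.
  by apply: (le_trans (ler_normB _ _)); rewrite mulrDr lerD ?bnd.
have H1 := HC mu smu s z s01 sd; have H2 := HC nu snu s z s01 sd.
rewrite -/Mm in H1; rewrite -/Mn in H2.
set A := \sum_p _ in H1 HS; set B := \sum_p _ in H2 HS.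
have -> : tilt s mu z - tilt s nu z =
  (tilt s mu z - A) - (tilt s nu z - B) + (A - B) by ring.
apply: (le_trans (ler_normD _ _)).
apply: (le_trans (lerD (le_trans (ler_normB _ _) (lerD H1 H2)) HS)).
by rewrite le_eqVlt; apply/orP; left; apply/eqP; ring.
Qed.

End tilt.

(** * Overlap of Gaussian mixtures *)

Definition overlap_kernel (R : realType) (d : nat) (s : R)
    (nu : probability (d.-tuple R) R) (y : d.-tuple R) : R :=
  \int[nu]_z expR (s ^+ 2 * dot y z).

(** This is [E (X.Y)^k / k!] for independent [X] and [Y], the coefficient of [s^(2k)] in
    [E exp (s^2 X.Y)]. *)
Definition moment_overlap (R : realType) (d : nat)
    (mu nu : probability (d.-tuple R) R) (k : nat) : R :=
  \sum_(a \in multi_indices d k)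
    (\int[mu]_y monomial y a) * (\int[nu]_y monomial y a) / (mfact a)%:R.

Section overlap.
Context (R : realType) (d : nat) (delta : R).
Hypothesis d0 : 0 < delta.
Implicit Types (mu nu : probability (d.-tuple R) R) (s : R) (x y z : d.-tuple R).

Lemma delta_le2 : delta <= 2 * delta.
Proof. by rewrite ler_peMl ?ler1n ?ltW. Qed.

Lemma overlap_exponent s y z : 0 <= s <= 1 -> s <= delta ->
  `|s ^+ 2 * dot y z| <= s ^+ 2 * (sqnorm y + sqnorm z) /\
  `|s ^+ 2 * dot y z| <= delta * (sqnorm y + sqnorm z).
Proof.
move=> /andP[s0 s1] sd; have h := norm_dot_le y z.
have q0 : 0 <= sqnorm y + sqnorm z by rewrite addr_ge0 ?sqnorm_ge0.
have hs : `|s ^+ 2 * dot y z| <= s ^+ 2 * (sqnorm y + sqnorm z).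
  by rewrite normrM ger0_norm ?sqr_ge0// ler_wpM2l ?sqr_ge0.
by split => //; apply: (le_trans hs); rewrite ler_wpM2r//; nra.
Qed.

Lemma overlap_kernel_le s y z : 0 <= s <= 1 -> s <= delta ->
  expR (s ^+ 2 * dot y z) <= sq_exp delta y * sq_exp delta z.
Proof.
move=> s01 sd; have [_ h] := overlap_exponent y z s01 sd.
by rewrite -expR_sum_sqnorm ler_expR (le_trans (ler_norm _)).
Qed.

Lemma integrable_overlap_kernel nu s y : subgauss delta nu ->
  0 <= s <= 1 -> s <= delta ->
  nu.-integrable setT (EFin \o (fun z => expR (s ^+ 2 * dot y z))).
Proof.
move=> sg s01 sd.
apply: (proj1 (@subgauss_dominated _ _ delta (sq_exp delta y) _ _ sg _ _)).
  by apply: measurableT_comp => //; apply: measurable_funM => //; exact: measurable_fun_dot.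
by move=> z; rewrite ger0_norm ?expR_ge0//; exact: overlap_kernel_le.
Qed.

Lemma measurable_overlap_kernel nu s :
  measurable_fun setT (overlap_kernel s nu).
Proof.
apply: (@measurable_fun_Rintegral _ _ _ _ _ nu (fun y z => expR (s ^+ 2 * dot y z))).
  by apply: measurableT_comp => //; apply: measurable_funM => //; exact: measurable_fun_dot.
by move=> y z; exact: expR_ge0.
Qed.

Lemma integrable_monomial mu a : subgauss delta mu ->
  mu.-integrable setT (EFin \o (fun y => monomial y a)).
Proof.
move=> sg; apply: (subgauss_poly d0 sg (@measurable_monomial R d a) ler01) => y.
by rewrite mul1r; exact: (norm_monomial_le y (erefl : multi_indices d _ a)).
Qed.

(** The truncated series of [exp (s^2 y.z)] after integration in [z]. Multi-indices are enumerated
    as a list, the form in which [Rintegral_sum] exchanges sum and integral. *)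
Let trunc (m : nat) s nu y : R :=
  \sum_(k < m) s ^+ k.*2 * \sum_(a <- finmap.enum_fset (fset_set (multi_indices d k)))
    (\int[nu]_z monomial z a) / (mfact a)%:R * monomial y a.

Let trunc_Rintegral m s mu nu : subgauss delta mu ->
  mu.-integrable setT (EFin \o trunc m s nu) /\
  \int[mu]_y trunc m s nu y = \sum_(k < m) s ^+ k.*2 * moment_overlap mu nu k.
Proof.
move=> sg.
have i0 (a : d.-tuple nat) := integrable_monomial a sg.
have H (k : 'I_m) := Rintegral_sum (finmap.enum_fset (fset_set (multi_indices d k)))
  (fun a => integrableZl measurableT ((\int[nu]_z monomial z a) / (mfact a)%:R) (i0 a)).
have i1 (k : 'I_m) := integrableZl measurableT (s ^+ k.*2) (H k).1.
have [i2 E2] := Rintegral_sum (index_enum 'I_m) i1.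
split; first exact: i2.
rewrite /trunc E2; apply: eq_bigr => k _; rewrite RintegralZl//; last exact: (H k).1.
congr (_ * _); rewrite (H k).2 /moment_overlap fsbig_finite; last exact: finite_multi_indices.
by apply: eq_bigr => a _; rewrite RintegralZl//; ring.
Qed.

Let overlap_kernel_trunc m : exists2 C : R, 0 < C &
  forall nu, subgauss (2 * delta) nu -> forall s y, 0 <= s <= 1 -> s <= delta ->
  `|overlap_kernel s nu y - trunc m s nu y| <=
    C * s ^+ m.*2 * (\int[nu]_z sq_exp (2 * delta) z) * sq_exp (2 * delta) y.
Proof.
have [K K0 KN] := pow_le_expR m d0.
exists K => // nu sg s y s01 sd.
have sg1 := subgauss_le delta_le2 sg.
have i0 (a : d.-tuple nat) := integrable_monomial a sg1.
pose T z := \sum_(k < m) s ^+ k.*2 * \sum_(a <- finmap.enum_fset (fset_set (multi_indices d k)))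
    monomial y a / (mfact a)%:R * monomial z a.
have H (k : 'I_m) := Rintegral_sum (finmap.enum_fset (fset_set (multi_indices d k)))
  (fun a => integrableZl measurableT (monomial y a / (mfact a)%:R) (i0 a)).
have i1 (k : 'I_m) := integrableZl measurableT (s ^+ k.*2) (H k).1.
have [i2 E2] := Rintegral_sum (index_enum 'I_m) i1.
have -> : trunc m s nu y = \int[nu]_z T z.
  rewrite /T E2; apply: eq_bigr => k _; rewrite RintegralZl//; last exact: (H k).1.
  congr (_ * _); rewrite (H k).2.
  by apply: eq_bigr => a _; rewrite RintegralZl//; ring.
have i3 := integrable_overlap_kernel y sg1 s01 sd.
rewrite -RintegralB//.
have -> : K * s ^+ m.*2 * (\int[nu]_z sq_exp (2 * delta) z) * sq_exp (2 * delta) y =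
  K * s ^+ m.*2 * sq_exp (2 * delta) y * \int[nu]_z sq_exp (2 * delta) z by ring.
apply: (proj2 (subgauss_dominated sg _ _)).
  apply: measurable_funB; apply/measurable_EFinP.
    exact: (measurable_int _ i3).
  exact: (measurable_int _ i2).
move=> z; have [h1 h2] := overlap_exponent y z s01 sd.
have -> : T z = exp_poly m (s ^+ 2 * dot y z).
  apply: eq_bigr => k _; rewrite exprMn -exprM mul2n -mulrA dot_multinomial.
  rewrite fsbig_finite; last exact: finite_multi_indices.
  by congr (_ * _); apply: eq_bigr => a _; ring.
apply: (le_trans (exp_taylor_le _ _)).
have S0 : 0 <= sqnorm y + sqnorm z by rewrite addr_ge0 ?sqnorm_ge0.
apply: (@le_trans _ _ ((s ^+ 2 * (sqnorm y + sqnorm z)) ^+ m *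
    expR (delta * (sqnorm y + sqnorm z)))).
  apply: ler_pM; rewrite ?exprn_ge0 ?expR_ge0 ?ler_expR//.
  by rewrite lerXn2r ?nnegrE ?(le_trans _ h1).
rewrite exprMn -exprM mul2n.
have -> : K * s ^+ m.*2 * sq_exp (2 * delta) y * sq_exp (2 * delta) z =
  s ^+ m.*2 * (K * (sq_exp (2 * delta) y * sq_exp (2 * delta) z)) by ring.
rewrite -expR_sum_sqnorm -[leLHS]mulrA ler_wpM2l ?exprn_ge0//; first by case/andP: s01.
apply: (@le_trans _ _ (K * expR (delta * (sqnorm y + sqnorm z)) *
    expR (delta * (sqnorm y + sqnorm z)))).
  by rewrite ler_wpM2r ?expR_ge0// KN.
by rewrite -mulrA -expRD ler_wpM2l ?(ltW K0)// ler_expR mulrDl !mul1r mulrDl.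
Qed.

(** The double expectation is expanded in two stages: the inner integral against [nu], with an error
    carrying a weight in [y], and then that error against [mu], which integrates the weight. *)
Lemma overlap_expansion m mu nu :
  subgauss (2 * delta) mu -> subgauss (2 * delta) nu ->
  exists2 C : R, 0 < C & forall s, 0 <= s <= 1 -> s <= delta ->
  mu.-integrable setT (EFin \o overlap_kernel s nu) /\
  `|\int[mu]_y overlap_kernel s nu y -
    \sum_(k < m) s ^+ k.*2 * moment_overlap mu nu k| <= C * s ^+ m.*2.
Proof.
move=> smu snu; have [K K0 HK] := overlap_kernel_trunc m.
have d20 : 0 < 2 * delta by rewrite mulr_gt0.
have smu1 := subgauss_le delta_le2 smu; have snu1 := subgauss_le delta_le2 snu.
have Mm1 := Rintegral_sq_exp_ge1 (ltW d20) smu.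
have Mn1 := Rintegral_sq_exp_ge1 (ltW d20) snu.
exists (K * (\int[nu]_z sq_exp (2 * delta) z) * \int[mu]_z sq_exp (2 * delta) z).
  by rewrite !mulr_gt0//; apply: lt_le_trans ltr01 _.
move=> s s01 sd.
have [i1 E1] := @trunc_Rintegral m s mu nu smu1.
have i2 : mu.-integrable setT (EFin \o overlap_kernel s nu).
  apply: (proj1 (@subgauss_dominated _ _ delta (\int[nu]_z sq_exp delta z) _ _ smu1 _ _)).
    exact: measurable_overlap_kernel.
  move=> y; rewrite mulrC; apply: (proj2 (subgauss_dominated snu1 _ _)).
    by apply: measurableT_comp => //; apply: measurable_funM => //; exact: measurable_fun_dot.
  by move=> z; rewrite ger0_norm ?expR_ge0//; exact: overlap_kernel_le.
split => //; rewrite -E1 -RintegralB//.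
have -> : K * (\int[nu]_z sq_exp (2 * delta) z) * (\int[mu]_z sq_exp (2 * delta) z) * s ^+ m.*2 =
  K * s ^+ m.*2 * (\int[nu]_z sq_exp (2 * delta) z) * \int[mu]_z sq_exp (2 * delta) z by ring.
apply: (proj2 (subgauss_dominated smu _ _)).
  apply: measurable_funB; first exact: measurable_overlap_kernel.
  by apply/measurable_EFinP; exact: (measurable_int _ i1).
by move=> y; exact: HK.
Qed.

End overlap.

(** * Gaussian convolutions *)

Definition vscale (R : realType) (d : nat) (s : R) (x : d.-tuple R) : d.-tuple R :=
  [tuple s * tnth x i | i < d].

Lemma sqnorm_vscale (R : realType) (d : nat) (s : R) (x : d.-tuple R) :
  sqnorm (vscale s x) = s ^+ 2 * sqnorm x.
Proof.
rewrite /sqnorm mulr_sumr; apply: eq_bigr => i _.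
by rewrite /vscale tnth_mktuple exprMn.
Qed.

Lemma dot_vscale (R : realType) (d : nat) (s : R) (x y : d.-tuple R) :
  dot (vscale s x) y = s * dot x y.
Proof.
by rewrite /dot mulr_sumr; apply: eq_bigr => i _; rewrite tnth_mktuple mulrA.
Qed.

Lemma sqnorm_vsub (R : realType) (d : nat) (x y : d.-tuple R) :
  sqnorm (vsub x y) = sqnorm x - 2 * dot x y + sqnorm y.
Proof.
rewrite /sqnorm /dot mulr_sumr -sumrB -big_split/=; apply: eq_bigr => i _.
by rewrite tnth_mktuple; ring.
Qed.

Definition vadd (R : realType) (d : nat) (x y : d.-tuple R) : d.-tuple R :=
  [tuple tnth x i + tnth y i | i < d].

Lemma sqnorm_vsub_vadd (R : realType) (d : nat) (x y z : d.-tuple R) :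
  sqnorm (vsub x (vadd y z)) =
  sqnorm (vsub x y) + sqnorm (vsub x z) - sqnorm x + 2 * dot y z.
Proof.
rewrite /sqnorm /dot mulr_sumr -big_split -sumrB -big_split/=; apply: eq_bigr => i _.
by rewrite !(tnth_mktuple (fun i => tnth _ i - tnth _ i)) tnth_mktuple; ring.
Qed.

Section gauss_conv.
Context (R : realType) (d : nat) (delta : R).
Hypothesis d0 : 0 < delta.
Implicit Types (mu nu : probability (d.-tuple R) R) (s : R) (x y z : d.-tuple R).

Lemma gauss_density_tilt s x y : 0 < s ->
  gauss_density (s ^- 2) (vsub x y) =
  gauss_density (s ^- 2) x * tilt_kernel s (vscale s x) y.
Proof.
move=> s0; rewrite /gauss_density -[RHS]mulrA -expRD; congr (_ * expR _).
by rewrite sqnorm_vsub dot_vscale; field; rewrite gt_eqF.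
Qed.

(** Completing the square: [|x-y|^2 + |x-z|^2 - |x|^2 = |x-y-z|^2 - 2 y.z]. What depends on [x] is a
    Gaussian density centred at [y + z], so integration in [x] leaves only [exp (s^2 y.z)]. *)
Lemma gauss_density_overlap s x y z : 0 < s ->
  gauss_density (s ^- 2) (vsub x y) * gauss_density (s ^- 2) (vsub x z) /
    gauss_density (s ^- 2) x =
  expR (s ^+ 2 * dot y z) * gauss_density (s ^- 2) (vsub x (vadd y z)).
Proof.
move=> s0; have t0 : 0 < s ^- 2 by rewrite invr_gt0 exprn_gt0.
have g0 := gauss_density_gt0 x t0.
apply: (mulIf (lt0r_neq0 g0)); rewrite divfK ?lt0r_neq0//.
rewrite /gauss_density; set c := _ `^ _.
transitivity (c * c * (expR (- (sqnorm (vsub x y) / (2 * s ^- 2))) *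
    expR (- (sqnorm (vsub x z) / (2 * s ^- 2))))); first by ring.
transitivity (c * c * (expR (s ^+ 2 * dot y z) *
  (expR (- (sqnorm (vsub x (vadd y z)) / (2 * s ^- 2))) *
    expR (- (sqnorm x / (2 * s ^- 2)))))); last by ring.
rewrite -!expRD; congr (_ * expR _); rewrite sqnorm_vsub_vadd.
by field; rewrite gt_eqF.
Qed.

Lemma gauss_conv_tilt s mu x : subgauss delta mu -> 0 < s <= 1 -> 2 * s <= delta ->
  gauss_conv mu (s ^- 2) x = gauss_density (s ^- 2) x * tilt s mu (vscale s x) /\
  mu.-integrable setT (EFin \o (fun y => gauss_density (s ^- 2) (vsub x y))).
Proof.
move=> sg /andP[s0 s1] sd.
have s01 : 0 <= s <= 1 by rewrite ltW.
have i1 := integrable_tilt_kernel (vscale s x) sg s01 sd.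
have E : (fun y => gauss_density (s ^- 2) (vsub x y)) =
    (fun y => gauss_density (s ^- 2) x * tilt_kernel s (vscale s x) y).
  by apply/funext => y; exact: gauss_density_tilt.
rewrite /gauss_conv E RintegralZl//; split => //.
exact: (integrableZl measurableT _ i1).
Qed.

Lemma measurable_gauss_conv mu t : 0 < t -> measurable_fun setT (gauss_conv mu t).
Proof.
move=> t0.
apply: (@measurable_fun_Rintegral _ _ _ _ _ mu (fun x y => gauss_density t (vsub x y))).
  by apply: measurable_fun_gauss_density; exact: measurable_fun_vsub.
by move=> x y; rewrite ltW// gauss_density_gt0.
Qed.

Lemma gauss_conv_ge0 mu t x : 0 < t -> 0 <= gauss_conv mu t x.
Proof. by move=> t0; apply: Rintegral_ge0 => y _; rewrite ltW// gauss_density_gt0. Qed.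

(** Tonelli with a nonnegative weight. The weight 1 gives total mass one; two successive uses, one
    for each mixture, reduce the overlap integral to shifted Gaussians. *)
Lemma integral_gauss_conv s mu (h : d.-tuple R -> R) :
  subgauss delta mu -> 0 < s <= 1 -> 2 * s <= delta ->
  measurable_fun setT h -> (forall x, 0 <= h x) ->
  (\int[lebesgue_tuple R d]_x (gauss_conv mu (s ^- 2) x * h x)%:E =
   \int[mu]_y \int[lebesgue_tuple R d]_x (gauss_density (s ^- 2) (vsub x y) * h x)%:E)%E.
Proof.
move=> sg s01 sd mh h0.
have t0 : 0 < s ^- 2 by rewrite invr_gt0 exprn_gt0//; case/andP: s01.
have mk : measurable_fun setT (fun z : d.-tuple R * d.-tuple R =>
    (gauss_density (s ^- 2) (vsub z.1 z.2) * h z.1)%:E).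
  apply/measurable_EFinP; apply: measurable_funM.
    by apply: measurable_fun_gauss_density; exact: measurable_fun_vsub.
  exact: measurableT_comp mh _.
rewrite -(fubini_tonelli (m1 := lebesgue_tuple R d) (m2 := mu) _ mk)/=; last first.
  by move=> z; rewrite lee_fin mulr_ge0// ltW// gauss_density_gt0.
apply: eq_integral => x _.
have [_ ix] := gauss_conv_tilt x sg s01 sd.
under [RHS]eq_integral do rewrite mulrC EFinM.
rewrite ge0_integralZl_EFin//; last 2 first.
- by move=> y _; rewrite lee_fin ltW// gauss_density_gt0.
- exact: (measurable_int _ ix).
rewrite mulrC EFinM; congr (_ * _)%E.
(* [gauss_conv] is real-valued through [fine]; integrability of the kernel in [y] ensures that
   nothing is lost. *)
by rewrite /gauss_conv /Rintegral fineK//; exact: integrable_fin_num ix.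
Qed.

Lemma integral_gauss_conv1 s mu :
  subgauss delta mu -> 0 < s <= 1 -> 2 * s <= delta ->
  (\int[lebesgue_tuple R d]_x (gauss_conv mu (s ^- 2) x)%:E = 1)%E.
Proof.
move=> sg s01 sd.
have t0 : 0 < s ^- 2 by rewrite invr_gt0 exprn_gt0//; case/andP: s01.
have := integral_gauss_conv sg s01 sd (h := cst 1) _ (fun=> ler01).
under eq_integral do rewrite mulr1.
move=> ->//.
under eq_integral => y _.
  under eq_integral do rewrite mulr1.
  rewrite integral_gauss_density//; over.
by rewrite integral_cst// mul1e; exact: probability_setT.
Qed.

Lemma integral_gauss_conv_overlap s mu nu :
  subgauss delta mu -> subgauss delta nu -> 0 < s <= 1 -> 2 * s <= delta ->
  mu.-integrable setT (EFin \o overlap_kernel s nu) ->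
  (\int[lebesgue_tuple R d]_x (gauss_conv mu (s ^- 2) x * gauss_conv nu (s ^- 2) x /
     gauss_density (s ^- 2) x)%:E = (\int[mu]_y overlap_kernel s nu y)%:E)%E.
Proof.
move=> smu snu s01 sd iJ; have /andP[s0 s1] := s01.
have t0 : 0 < s ^- 2 by rewrite invr_gt0 exprn_gt0.
have mg : measurable_fun setT (fun x : d.-tuple R => (gauss_density (s ^- 2) x)^-1).
  apply: measurable_fun_inv; first exact: measurable_fun_gauss_density.
  by move=> x; rewrite ltW// gauss_density_gt0.
under eq_integral do rewrite -mulrA.
rewrite (integral_gauss_conv smu s01 sd)//; last 2 first.
- by apply: measurable_funM => //; exact: measurable_gauss_conv.
- by move=> x; rewrite divr_ge0 ?gauss_conv_ge0// ltW// gauss_density_gt0.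
rewrite /Rintegral fineK; last exact: integrable_fin_num iJ.
apply: eq_integral => y _.
under eq_integral do rewrite mulrCA.
rewrite (integral_gauss_conv snu s01 sd)//; last 2 first.
- apply: measurable_funM => //; apply: measurable_fun_gauss_density.
  exact: measurable_fun_vsub.
- by move=> x; rewrite divr_ge0// ltW// gauss_density_gt0.
rewrite /overlap_kernel /Rintegral fineK; last first.
  apply: integrable_fin_num => //; apply: integrable_overlap_kernel snu _ _ => //.
    by rewrite ltW.
  by apply: le_trans sd; rewrite ler_peMl ?ler1n ?ltW.
apply: eq_integral => z _.
transitivity (\int[lebesgue_tuple R d]_x
    ((expR (s ^+ 2 * dot y z))%:E * (gauss_density (s ^- 2) (vsub x (vadd y z)))%:E))%E.
  apply: eq_integral => x _; rewrite -EFinM; congr EFin.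
  by rewrite -gauss_density_overlap//; ring.
rewrite ge0_integralZl_EFin ?expR_ge0//.
- by rewrite integral_gauss_density// mule1.
- by move=> x _; rewrite lee_fin ltW// gauss_density_gt0.
- apply/measurable_EFinP; apply: measurable_fun_gauss_density.
  exact: measurable_fun_vsub.
Qed.

End gauss_conv.

(** * Asymptotics of the divergences *)

(** With [t = s^-2], the factor [t^m] is [s^(-2m)] and an error [C s] tends to 0. Finiteness of the
    divergence is part of the hypothesis, and only for small [s], that is, for large [t]. *)
Lemma cvg_of_inv_sqrt_rate (R : realType) (m : nat) (F : R -> \bar R) (l C s0 : R) :
  0 < s0 -> 0 < C ->
  (forall s : R, 0 < s <= s0 ->
    exists2 I : R, F (s ^- 2) = I%:E & `|s ^- m.*2 * I - l| <= C * s) ->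
  ((t ^+ m)%:E * F t)%E @[t --> +oo%R] --> l%:E.
Proof.
move=> s00 C0 H.
have key e : 0 < e -> \forall t \near +oo%R,
    exists2 I : R, F t = I%:E & `|t ^+ m * I - l| <= e.
  (* For [t >= s1^-2] the corresponding [s] is at most [s1], so the rate applies and [C s <= e]. *)
  move=> e0; set s1 := Num.min s0 (e / C).
  have s10 : 0 < s1 by rewrite lt_min s00 divr_gt0.
  near=> t.
  have ts1 : s1 ^- 2 <= t by near: t; apply: nbhs_pinfty_ge; exact: num_real.
  have t0 : 0 < t by apply: lt_le_trans ts1; rewrite invr_gt0 exprn_gt0.
  set s := (Num.sqrt t)^-1.
  have sq0 : 0 < s by rewrite invr_gt0 sqrtr_gt0.
  have st : s ^- 2 = t by rewrite exprVn invrK sqr_sqrtr ?ltW.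
  have ss1 : s <= s1.
    rewrite -(@ler_pXn2r _ 2) ?nnegrE ?(ltW s10) ?(ltW sq0)//.
    by rewrite -[leRHS]invrK -[leLHS]invrK lef_pV2 ?posrE ?invr_gt0 ?exprn_gt0// st.
  have [|I FI HI] := H s.
    by rewrite sq0 (le_trans ss1)// ge_min lexx.
  rewrite st in FI; exists I => //.
  have <- : s ^- m.*2 = t ^+ m by rewrite -[in RHS]st [RHS]exprVn -exprM mul2n.
  apply: (le_trans HI); rewrite mulrC -ler_pdivlMr//.
  by apply: (le_trans ss1); rewrite ge_min lexx orbT.
apply/fine_cvgP; split.
  apply: filterS (key 1 ltr01) => t [I -> _] //.
apply/cvgrPdist_le => e e0; apply: filterS (key e e0) => t [I FI HI].
by rewrite distrC /= FI.
Unshelve. all: by end_near.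
Qed.

Section asymptotics.
Context (R : realType) (d : nat) (delta : R) (m : nat)
  (mu nu : probability (d.-tuple R) R).
Hypothesis (d0 : 0 < delta) (d40 : 40 * delta <= 1).
Hypothesis (smu : subgauss (2 * delta) mu) (snu : subgauss (2 * delta) nu).
Hypothesis m0 : (0 < m)%N.
Hypothesis match_m : forall k, (k < m)%N -> forall a, multi_indices d k a ->
  \int[mu]_y monomial y a = \int[nu]_y monomial y a.

Let lim : R := \sum_(a \in multi_indices d m)
  (mfact a)%:R^-1 * `|\int[mu]_y monomial y a - \int[nu]_y monomial y a| ^+ 2.

Let smu1 := subgauss_le (delta_le2 d0) smu.
Let snu1 := subgauss_le (delta_le2 d0) snu.

Let p s := gauss_conv mu (s ^- 2).
Let q s := gauss_conv nu (s ^- 2).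
Let rho s (x : d.-tuple R) := gauss_density (s ^- 2) x.
Let lam := lebesgue_tuple R d.

Let rho_gt0 (s : R) x : 0 < s -> 0 < rho s x.
Proof. by move=> s0; rewrite gauss_density_gt0// invr_gt0 exprn_gt0. Qed.

Let integrable_overlap mu' nu' (s : R) : subgauss (2 * delta) mu' -> subgauss (2 * delta) nu' ->
  0 < s <= 1 -> 2 * s <= delta ->
  lam.-integrable setT (EFin \o (fun x => gauss_conv mu' (s ^- 2) x *
    gauss_conv nu' (s ^- 2) x / rho s x)) /\
  \int[lam]_x (gauss_conv mu' (s ^- 2) x * gauss_conv nu' (s ^- 2) x / rho s x) =
  \int[mu']_y overlap_kernel s nu' y.
Proof.
move=> sm sn s01 sd; have /andP[s0 s1] := s01.
have t0 : 0 < s ^- 2 by rewrite invr_gt0 exprn_gt0.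
have sd1 : s <= delta by apply: le_trans sd; rewrite ler_peMl ?ler1n ?ltW.
have s01' : 0 <= s <= 1 by rewrite ltW.
(* Only integrability is wanted here, so the expansion is taken with an empty sum. *)
have [C _ /(_ s s01' sd1)[iJ _]] := overlap_expansion d0 0 sm sn.
have sm1 := subgauss_le (delta_le2 d0) sm; have sn1 := subgauss_le (delta_le2 d0) sn.
have E := integral_gauss_conv_overlap sm1 sn1 s01 sd iJ.
split; last by rewrite [LHS]/Rintegral E.
apply/integrableP; split.
  apply/measurable_EFinP; apply: measurable_funM.
    by apply: measurable_funM; exact: measurable_gauss_conv.
  apply: measurable_fun_inv; first exact: measurable_fun_gauss_density.
  by move=> x; rewrite ltW// rho_gt0.
under eq_integral => x _.
  rewrite /= ger0_norm; last first.
    apply: divr_ge0; last exact: ltW (rho_gt0 x s0).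
    by apply: mulr_ge0; exact: gauss_conv_ge0.
  over.
by rewrite E ltry.
Qed.

Let overlap_lim : moment_overlap mu mu m - 2 * moment_overlap mu nu m +
  moment_overlap nu nu m = lim.
Proof.
rewrite /lim /moment_overlap !fsbig_finite; try exact: finite_multi_indices.
rewrite mulr_sumr -sumrB -big_split/=; apply: eq_bigr => a _.
by rewrite real_normK ?num_real//; ring.
Qed.

Let overlap_match k : (k < m)%N ->
  moment_overlap mu mu k - 2 * moment_overlap mu nu k + moment_overlap nu nu k = 0.
Proof.
move=> km; rewrite /moment_overlap !fsbig_finite; try exact: finite_multi_indices.
rewrite mulr_sumr -sumrB -big_split/= big1_seq// => a /andP[_].
rewrite in_fset_set; last exact: finite_multi_indices.
by rewrite inE => /(match_m km) ->; ring.
Qed.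

(** The square opens into three overlaps, each expanded through order [m]. At order [k] they combine
    into the weighted squared differences of the [k]-th moments, which vanish for [k < m] and give
    [lim] at [k = m]. *)
Let sq_diff_expansion : exists2 C : R, 0 < C & forall s : R, 0 < s <= 1 -> 2 * s <= delta ->
  lam.-integrable setT (EFin \o (fun x => (p s x - q s x) ^+ 2 / rho s x)) /\
  `|\int[lam]_x ((p s x - q s x) ^+ 2 / rho s x) - s ^+ m.*2 * lim| <= C * s ^+ m.+1.*2.
Proof.
have [C1 C10 H1] := overlap_expansion d0 m.+1 smu smu.
have [C2 C20 H2] := overlap_expansion d0 m.+1 smu snu.
have [C3 C30 H3] := overlap_expansion d0 m.+1 snu snu.
exists (C1 + 2 * C2 + C3); first by rewrite !addr_gt0 ?mulr_gt0.
move=> s s01 sd; have /andP[s0 s1] := s01.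
have sd1 : s <= delta by apply: le_trans sd; rewrite ler_peMl ?ler1n ?ltW.
have s01' : 0 <= s <= 1 by rewrite ltW.
have [_ {}H1] := H1 s s01' sd1; have [_ {}H2] := H2 s s01' sd1.
have [_ {}H3] := H3 s s01' sd1.
have [i1 E1] := integrable_overlap smu smu s01 sd.
have [i2 E2] := integrable_overlap smu snu s01 sd.
have [i3 E3] := integrable_overlap snu snu s01 sd.
rewrite -E1 in H1; rewrite -E2 in H2; rewrite -E3 in H3.
have i2' := integrableZl measurableT 2 i2.
have i12 := integrableB measurableT i1 i2'.
have i123 := integrableD measurableT i12 i3.
have E : (fun x => (p s x - q s x) ^+ 2 / rho s x) = (fun x =>
    gauss_conv mu (s ^- 2) x * gauss_conv mu (s ^- 2) x / rho s x -
    2 * (gauss_conv mu (s ^- 2) x * gauss_conv nu (s ^- 2) x / rho s x) +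
    gauss_conv nu (s ^- 2) x * gauss_conv nu (s ^- 2) x / rho s x).
  by apply/funext => x; rewrite /p /q; ring.
rewrite E; split; first exact: i123.
rewrite RintegralD// RintegralB// RintegralZl//.
have -> : s ^+ m.*2 * lim = \sum_(k < m.+1) s ^+ k.*2 * moment_overlap mu mu k -
    2 * (\sum_(k < m.+1) s ^+ k.*2 * moment_overlap mu nu k) +
    \sum_(k < m.+1) s ^+ k.*2 * moment_overlap nu nu k.
  rewrite [X in _ - X + _]mulr_sumr -sumrB -big_split/= big_ord_recr/= big1; last first.
    move=> k _; have := overlap_match (ltn_ord k) => /(congr1 ( *%R (s ^+ k.*2))).
    by rewrite mulr0 => <-; ring.
  by rewrite -overlap_lim add0r; ring.
set a1 := \int[lam]_x _ in H1 *; set b1 := \sum_(k < _) _ in H1 *.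
set a2 := \int[lam]_x _ in H2 *; set b2 := \sum_(k < _) _ in H2 *.
set a3 := \int[lam]_x _ in H3 *; set b3 := \sum_(k < _) _ in H3 *.
move: H1 H2 H3; rewrite !ler_norml; move: (s ^+ _) => r; lra.
Qed.

(** The step common to both divergences, used with [(kap, la) = (1, 0)] for chi^2 and [(1/2, 1)] for
    KL. The [la] term integrates to 0 because [p s] and [q s] both have mass one. Domination by the
    weight also yields integrability of [F], hence a finite divergence. *)
Let divergence_expansion (F : R -> d.-tuple R -> R) (kap la C : R) :
  0 < C -> (forall s : R, 0 < s -> measurable_fun setT (F s)) ->
  (forall (s : R) x, 0 < s <= 1 -> 2 * s <= delta ->
    `|F s x - (kap * ((p s x - q s x) ^+ 2 / rho s x) + la * (p s x - q s x))| <=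
    C * s ^+ m.*2.+1 * (rho s x * expR (s ^+ 2 * sqnorm x / 4))) ->
  exists2 K : R, 0 < K & forall s : R, 0 < s <= Num.min 1 (delta / 2) ->
    exists2 I : R, (\int[lam]_x (F s x)%:E)%E = I%:E &
      `|s ^- m.*2 * I - kap * lim| <= K * s.
Proof.
move=> C0 mF HF; have [D D0 HD] := sq_diff_expansion.
(* [D] comes from the quadratic term, whose error [s^(2m+2)] is weakened to [s^(2m+1)]; [2^(d/2)] is
   the mass of the dominating weight. *)
exists (`|kap| * D + C * 2 `^ (d%:R / 2)).
  by rewrite ltr_wpDl ?mulr_ge0 ?(ltW D0)// mulr_gt0// powR_gt0.
move=> s; rewrite le_min => /andP[s0 /andP[s1 sd]].
rewrite ler_pdivlMr// mulrC in sd.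
have s01 : 0 < s <= 1 by rewrite s0.
have t0 : 0 < s ^- 2 by rewrite invr_gt0 exprn_gt0.
have [iD {}HD] := HD s s01 sd.
have int_conv mu' : subgauss delta mu' ->
    lam.-integrable setT (EFin \o gauss_conv mu' (s ^- 2)) /\
    \int[lam]_x gauss_conv mu' (s ^- 2) x = 1.
  move=> sg; have E := integral_gauss_conv1 sg s01 sd.
  split; last by rewrite /Rintegral E.
  apply/integrableP; split; first by apply/measurable_EFinP; exact: measurable_gauss_conv.
  under eq_integral do rewrite /= ger0_norm ?gauss_conv_ge0//.
  by rewrite E ltry.
have [ip Ep] := int_conv _ smu1; have [iq Eq] := int_conv _ snu1.
pose G x := kap * ((p s x - q s x) ^+ 2 / rho s x) + la * (p s x - q s x).
have ipq := integrableB measurableT ip iq.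
have iD' := integrableZl measurableT kap iD.
have ipq' := integrableZl measurableT la ipq.
have iG : lam.-integrable setT (EFin \o G) by exact: (integrableD measurableT iD' ipq').
have EG : \int[lam]_x G x = kap * \int[lam]_x ((p s x - q s x) ^+ 2 / rho s x).
  by rewrite /G RintegralD// RintegralZl// RintegralZl// RintegralB// Ep Eq subrr mulr0 addr0.
have Ew := integral_gauss_density_tilt d t0.
rewrite invrK in Ew.
have iw : lam.-integrable setT
    (EFin \o (fun x => rho s x * expR (s ^+ 2 * sqnorm x / 4))).
  apply/integrableP; split.
    apply/measurable_EFinP; apply: measurable_funM; first exact: measurable_fun_gauss_density.
    apply: measurableT_comp => //; apply: measurable_funM => //.
    by apply: measurable_funM => //; exact: measurable_sqnorm.
  under eq_integral => x _.
    rewrite /= ger0_norm; last by rewrite mulr_ge0 ?expR_ge0// ltW// rho_gt0.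
    over.
  by rewrite Ew ltry.
have iw' := integrableZl measurableT (C * s ^+ m.*2.+1) iw.
have mG : measurable_fun setT G by apply/measurable_EFinP; exact: measurable_int iG.
have iE : lam.-integrable setT (EFin \o (fun x => F s x - G x)).
  apply: le_integrable iw' => //.
    by apply/measurable_EFinP; apply: measurable_funB => //; exact: mF.
  move=> x _ /=; rewrite lee_fin; apply: le_trans (HF s x s01 sd) _; exact: ler_norm.
have iF : lam.-integrable setT (EFin \o F s).
  have -> : F s = (fun x => (F s x - G x) + G x) by apply/funext => x; rewrite subrK.
  exact: (integrableD measurableT iE iG).
exists (\int[lam]_x F s x).
  by rewrite /Rintegral fineK//; exact: integrable_fin_num iF.
have bE : `|\int[lam]_x F s x - \int[lam]_x G x| <= C * s ^+ m.*2.+1 * 2 `^ (d%:R / 2).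
  rewrite -RintegralB//; apply: (le_trans (le_normr_Rintegral _ iE)) => //.
  have -> : 2 `^ (d%:R / 2) = \int[lam]_x (rho s x * expR (s ^+ 2 * sqnorm x / 4)).
    by rewrite /Rintegral Ew.
  rewrite -RintegralZl//; apply: le_Rintegral => //.
    exact: (integrable_norm iE).
  by move=> x _; exact: HF.
rewrite EG in bE.
have s2m : 0 < s ^+ m.*2 by rewrite exprn_gt0.
rewrite -(ler_pM2l s2m) -[X in X * `|_|]gtr0_norm// -normrM mulrBr mulrA divff ?gt_eqF// mul1r.
set J := \int[lam]_x _ in HD bE.
have -> : \int[lam]_x F s x - s ^+ m.*2 * (kap * lim) =
  (\int[lam]_x F s x - kap * J) + kap * (J - s ^+ m.*2 * lim) by ring.
apply: (le_trans (ler_normD _ _)); rewrite [X in _ + X]normrM.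
have kD : `|kap| * `|J - s ^+ m.*2 * lim| <= `|kap| * (D * s ^+ m.+1.*2) by rewrite ler_wpM2l.
apply: (le_trans (lerD bE kD)).
have -> : s ^+ m.*2 * ((`|kap| * D + C * 2 `^ (d%:R / 2)) * s) =
  C * s ^+ m.*2.+1 * 2 `^ (d%:R / 2) + `|kap| * (D * s ^+ m.*2.+1) by rewrite exprS; ring.
rewrite lerD2l ler_wpM2l// ler_wpM2l ?(ltW D0)// doubleS [leLHS]exprS.
by rewrite ler_piMl// exprn_ge0 ?ltW.
Qed.

Let pointwise_bounds : exists A B D : R, [/\ 0 < A, 0 < B, 0 < D &
  forall (s : R) x, 0 < s <= 1 -> 2 * s <= delta ->
  let E := sq_exp (2 * delta) (vscale s x) in
  exists f g : R, [/\ p s x = rho s x * f /\ q s x = rho s x * g,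
    0 < f /\ 0 < g, `|f - g| <= A * s ^+ m * E,
    f^-1 <= B * E /\ g^-1 <= B * E & `|g - 1| <= D * s * E]].
Proof.
have [A A0 HA] := tilt_sub_le d0 smu snu match_m.
have [D D0 HD] := tilt_sub1_le d0 snu.
have Mm1 := Rintegral_sq_exp_ge1 (ltW d0) smu1.
have Mn1 := Rintegral_sq_exp_ge1 (ltW d0) snu1.
exists A, (\int[mu]_y sq_exp delta y + \int[nu]_y sq_exp delta y), D.
split => //; first by lra.
move=> s x s01 sd E; have /andP[s0 s1] := s01.
have s01' : 0 <= s <= 1 by rewrite ltW.
have [pE _] := gauss_conv_tilt x smu1 s01 sd.
have [qE _] := gauss_conv_tilt x snu1 s01 sd.
have [f0 fi] := tilt_gt0_inv_le d0 (vscale s x) smu1 s01' sd.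
have [g0 gi] := tilt_gt0_inv_le d0 (vscale s x) snu1 s01' sd.
exists (tilt s mu (vscale s x)), (tilt s nu (vscale s x)); split => //.
- exact: HA.
- have e0 : 0 <= sq_exp delta (vscale s x) := expR_ge0 _.
  have eE : sq_exp delta (vscale s x) <= E by apply: sq_exp_le; exact: delta_le2.
  by split; [apply: (le_trans fi)|apply: (le_trans gi)]; apply: ler_pM => //; lra.
- exact: HD.
Qed.

(** Five weights of exponent [2 delta] give [10 delta |z|^2], at most [|z|^2 / 4] exactly when
    [40 delta <= 1]. *)
Let sq_exp_pow5_le (s : R) (x : d.-tuple R) :
  sq_exp (2 * delta) (vscale s x) ^+ 5 <= expR (s ^+ 2 * sqnorm x / 4).
Proof.
rewrite /sq_exp sqnorm_vscale -expRM_natl ler_expR.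
have : 0 <= s ^+ 2 * sqnorm x by rewrite mulr_ge0 ?sqr_ge0 ?sqnorm_ge0.
move: (s ^+ 2 * sqnorm x) d40 => w; nra.
Qed.

Let measurable_pq (s : R) : 0 < s ->
  measurable_fun setT (p s) /\ measurable_fun setT (q s).
Proof.
by move=> s0; split; apply: measurable_gauss_conv; rewrite invr_gt0 exprn_gt0.
Qed.

Let measurable_q_inv (s : R) : 0 < s -> measurable_fun setT (fun x => (q s x)^-1).
Proof.
move=> s0; apply: measurable_fun_inv; first exact: (measurable_pq s0).2.
by move=> x; apply: gauss_conv_ge0; rewrite invr_gt0 exprn_gt0.
Qed.

(** The cost of replacing [(f - g)^2 / g] by [(f - g)^2]: since [1/g - 1 = - (g - 1) / g], one more
    power of [s] is gained. Four powers of [E] suffice; the fifth is added to share the weight with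
    the KL remainder. *)
Let sq_diff_error (A B D r s E f g : R) : 0 < A -> 0 < B -> 0 < D -> 0 < r ->
  0 < s <= 1 -> 1 <= E -> 0 < g -> `|f - g| <= A * s ^+ m * E ->
  g^-1 <= B * E -> `|g - 1| <= D * s * E ->
  `|r * ((f - g) ^+ 2 * (g^-1 - 1))| <= A ^+ 2 * D * B * s ^+ m.*2.+1 * (r * E ^+ 5).
Proof.
move=> A0 B0 D0 r0 /andP[s0 s1] E1 g0 Hfg Hg H1.
have E0 : 0 <= E by lra.
have -> : g^-1 - 1 = - (g - 1) * g^-1 by field; rewrite gt_eqF.
rewrite normrM normrM normrX normrM normrN (gtr0_norm r0) normfV (gtr0_norm g0).
apply: (@le_trans _ _ (r * ((A * s ^+ m * E) ^+ 2 * (D * s * E * (B * E))))).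
  rewrite ler_wpM2l ?(ltW r0)//; apply: ler_pM; rewrite ?mulr_ge0 ?invr_ge0 ?(ltW g0)//.
    by rewrite lerXn2r ?nnegrE ?(le_trans _ Hfg).
  by apply: ler_pM => //; rewrite invr_ge0 ltW.
have -> : r * ((A * s ^+ m * E) ^+ 2 * (D * s * E * (B * E))) =
  A ^+ 2 * D * B * s ^+ m.*2.+1 * (r * E ^+ 4).
  by rewrite -addnn [s ^+ (m + m).+1]exprS exprD; ring.
rewrite ler_wpM2l//; first by rewrite !mulr_ge0 ?exprn_ge0 ?ltW.
by rewrite ler_wpM2l ?(ltW r0)// ler_weXn2l.
Qed.

Lemma chi2_rate : exists2 K : R, 0 < K &
  forall s, 0 < s <= Num.min 1 (delta / 2) ->
  exists2 I : R, chi2 (p s) (q s) = I%:E & `|s ^- m.*2 * I - lim| <= K * s.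
Proof.
have [A [B [D [A0 B0 D0 H]]]] := pointwise_bounds.
have [|s s0|s x s01 sd|K K0 HK] := @divergence_expansion
  (fun s x => (p s x - q s x) ^+ 2 / q s x) 1 0 (A ^+ 2 * D * B).
- by rewrite !mulr_gt0 ?exprn_gt0.
- apply: measurable_funM; last exact: measurable_q_inv.
  by apply: measurable_funX; apply: measurable_funB; have [] := measurable_pq s0.
- have [f [g [[-> ->] [f0 g0] Hfg [_ Hg] H1]]] := H s x s01 sd.
  have r0 : 0 < rho s x by apply: rho_gt0; case/andP: s01.
  have E1 : 1 <= sq_exp (2 * delta) (vscale s x) by rewrite sq_exp_ge1// mulr_ge0 ?ltW.
  have c0 : 0 <= A ^+ 2 * D * B * s ^+ m.*2.+1.
    by rewrite !mulr_ge0 ?exprn_ge0 ?ltW//; case/andP: s01.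
  have := sq_diff_error A0 B0 D0 r0 s01 E1 g0 Hfg Hg H1.
  set r := rho s x in r0 *.
  have -> : r * ((f - g) ^+ 2 * (g^-1 - 1)) = (r * f - r * g) ^+ 2 / (r * g) -
     (1 * ((r * f - r * g) ^+ 2 / r) + 0 * (r * f - r * g)).
    by field; rewrite !gt_eqF.
  move=> /le_trans; apply; rewrite ler_wpM2l// ler_wpM2l ?(ltW r0)//.
- by exists K => // s hs; have [I EI HI] := HK s hs; exists I => //; rewrite mul1r in HI.
Qed.

(** Apply the expansion of [r ln r] at [r = f / g] and multiply by [g]: [f ln (f/g) = (f - g) + (f -
    g)^2 / (2 g) + g eps]. The linear term integrates to 0, the quadratic one is half of the chi^2
    integrand, and [g eps] is cubic in [f - g]. *)
Lemma KL_rate : exists2 K : R, 0 < K &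
  forall s, 0 < s <= Num.min 1 (delta / 2) ->
  exists2 I : R, KL (p s) (q s) = I%:E & `|s ^- m.*2 * I - 2^-1 * lim| <= K * s.
Proof.
have [A [B [D [A0 B0 D0 H]]]] := pointwise_bounds.
have A3B2 : 0 < A ^+ 3 * B ^+ 2 by rewrite mulr_gt0 ?exprn_gt0.
have A2DB : 0 < A ^+ 2 * D * B by rewrite !mulr_gt0 ?exprn_gt0.
have [|s s0|s x s01 sd|K K0 HK] := @divergence_expansion
  (fun s x => ln (p s x / q s x) * p s x) 2^-1 1
  (A ^+ 2 * D * B + 2 * (A ^+ 3 * B ^+ 2)); last by exists K.
- lra.
- have [mp mq] := measurable_pq s0.
  apply: measurable_funM => //; apply: measurableT_comp => //.
  by apply: measurable_funM => //; exact: measurable_q_inv.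
have [f [g [[-> ->] [f0 g0] Hfg [Hf Hg] H1]]] := H s x s01 sd.
have r0 : 0 < rho s x by apply: rho_gt0; case/andP: s01.
have E1 : 1 <= sq_exp (2 * delta) (vscale s x) by rewrite sq_exp_ge1// mulr_ge0 ?ltW.
have E5 := sq_exp_pow5_le s x.
have /andP[s0 s1] := s01.
have := sq_diff_error A0 B0 D0 r0 s01 E1 g0 Hfg Hg H1.
set r := rho s x in r0 *; set E := sq_exp _ _ in Hfg Hf Hg H1 E1 E5 *.
have E0 : 0 <= E by lra.
have fg0 : 0 < f / g by rewrite divr_gt0.
have := xlnx_taylor fg0.
set eps := f / g * ln (f / g) - _ - _ => Heps Hsq.
have -> : ln (r * f / (r * g)) * (r * f) -
    (2^-1 * ((r * f - r * g) ^+ 2 / r) + 1 * (r * f - r * g)) =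
    2^-1 * (r * ((f - g) ^+ 2 * (g^-1 - 1))) + r * (g * eps).
  rewrite /eps -mulf_div divff ?gt_eqF// mul1r; move: (ln _) => l.
  by field; rewrite !gt_eqF.
have Hgeps : `|r * (g * eps)| <= 2 * (A ^+ 3 * B ^+ 2) * s ^+ m.*2.+1 * (r * E ^+ 5).
  (* Three weights come from [(f - g)^3] and two from the inverses: this is the fifth power of
     [E]. *)
  have g_eps : `|g * eps| <= `|f - g| ^+ 3 * (g^-1 * g^-1 + f^-1 * g^-1).
    rewrite normrM (gtr0_norm g0).
    have -> : `|f - g| ^+ 3 * (g^-1 * g^-1 + f^-1 * g^-1) =
        g * (`|f / g - 1| ^+ 3 * (1 + (f / g)^-1)).
      have -> : f / g - 1 = (f - g) / g by field; rewrite gt_eqF.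
      rewrite normrM normfV (gtr0_norm g0); move: `|_| => w.
      by field; rewrite !gt_eqF.
    by rewrite ler_wpM2l ?(ltW g0).
  rewrite normrM (gtr0_norm r0).
  have fi0 : 0 <= f^-1 by rewrite invr_ge0 ltW.
  have gi0 : 0 <= g^-1 by rewrite invr_ge0 ltW.
  have BE0 : 0 <= B * E by rewrite mulr_ge0 ?(ltW B0).
  have h2 : g^-1 * g^-1 + f^-1 * g^-1 <= 2 * (B * E) ^+ 2.
    by rewrite mulrDl !mul1r expr2; apply: lerD; apply: ler_pM.
  have h3 : `|f - g| ^+ 3 <= (A * s ^+ m * E) ^+ 3.
    by rewrite lerXn2r ?nnegrE ?(le_trans _ Hfg).
  (* Positivity of [m] enters here, through [2 m + 1 <= 3 m]. *)
  have h4 : s ^+ (m * 3) <= s ^+ m.*2.+1.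
    by apply: ler_wiXn2l; rewrite ?(ltW s0)// mulnS muln2 -add1n leq_add2r.
  apply: (@le_trans _ _ (r * ((A * s ^+ m * E) ^+ 3 * (2 * (B * E) ^+ 2)))).
    rewrite ler_wpM2l ?(ltW r0)//; apply: (le_trans g_eps).
    by apply: ler_pM; rewrite ?exprn_ge0 ?addr_ge0 ?mulr_ge0.
  have -> : r * ((A * s ^+ m * E) ^+ 3 * (2 * (B * E) ^+ 2)) =
      2 * (A ^+ 3 * B ^+ 2) * s ^+ (m * 3) * (r * E ^+ 5).
    by rewrite exprM; ring.
  apply: ler_wpM2r; first by apply: mulr_ge0; [exact: ltW|exact: exprn_ge0].
  by apply: ler_wpM2l => //; lra.
apply: (le_trans (ler_normD _ _)).
rewrite normrM ger0_norm ?invr_ge0//.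
have s2m : 0 < s ^+ m.*2.+1 by rewrite exprn_gt0.
have Q0 : 0 <= A ^+ 2 * D * B * s ^+ m.*2.+1 * (r * E ^+ 5).
  by apply: mulr_ge0; apply: mulr_ge0; rewrite ?exprn_ge0 //; exact: ltW.
apply: (@le_trans _ _ ((A ^+ 2 * D * B + 2 * (A ^+ 3 * B ^+ 2)) * s ^+ m.*2.+1 *
    (r * E ^+ 5))); last first.
  apply: ler_wpM2l; first by rewrite mulr_ge0 ?(ltW s2m)//; lra.
  by rewrite ler_wpM2l ?(ltW r0).
rewrite [leRHS]mulrAC [(_ + _) * _]mulrDl [leRHS]mulrDl ![_ * (r * _) * _]mulrAC.
by apply: lerD => //; lra.
Qed.

End asymptotics.

Theorem theorem2p5 (R : realType) (d : nat)
    (mu nu : probability (d.-tuple R) R)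
    (d1 d2 : measure_display)
    (O1 : measurableType d1) (O2 : measurableType d2)
    (P : probability O1 R) (Q : probability O2 R)
    (X : {RV P >-> d.-tuple R}) (Y : {RV Q >-> d.-tuple R})
    (hX : has_law X mu) (hY : has_law Y nu)
    (beta : R) (beta_gt0 : 0 < beta) (hE : cond_E X Y beta)
    (n : nat) (hM : cond_M X Y n) :
  ((t ^+ n.+1)%:E * chi2 (gauss_conv mu t) (gauss_conv nu t))%E
    @[t --> +oo%R] -->
    (\sum_(a \in multi_indices d n.+1)
       (mfact a)%:R^-1 * `|moment X a - moment Y a| ^+ 2)%:E
  /\
  ((t ^+ n.+1)%:E * KL (gauss_conv mu t) (gauss_conv nu t))%E
    @[t --> +oo%R] -->
    (2^-1 * \sum_(a \in multi_indices d n.+1)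
       (mfact a)%:R^-1 * `|moment X a - moment Y a| ^+ 2)%:E.
Proof.
(* [beta / 4] gives [2 delta <= beta / 2], the exponent left after removing the centering; [1/40]
   makes five weights integrable against the Gaussian. *)
set delta := Num.min (beta / 4) 40^-1.
have d0 : 0 < delta by rewrite lt_min divr_gt0 ?invr_gt0 ?ltr0n.
have d40 : 40 * delta <= 1.
  have : delta <= 40^-1 by rewrite ge_min lexx orbT.
  by move: delta d0 => del ? ?; lra.
have dbeta : 2 * delta <= beta / 2.
  have : delta <= beta / 4 by rewrite ge_min lexx.
  by move: delta d0 {d40} => del ? ?; lra.
have smu := subgauss_le dbeta (exp_sq_integrable_subgauss hX beta_gt0 hE.1).
have snu := subgauss_le dbeta (exp_sq_integrable_subgauss hY beta_gt0 hE.2).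
have d20 : 0 < 2 * delta by rewrite mulr_gt0.
have mX a : moment X a = \int[mu]_y monomial y a.
  by apply: moment_Rintegral hX _ _; exact: integrable_monomial d20 _ _ smu.
have mY a : moment Y a = \int[nu]_y monomial y a.
  by apply: moment_Rintegral hY _ _; exact: integrable_monomial d20 _ _ snu.
have match_m k : (k < n.+1)%N -> forall a, multi_indices d k a ->
    \int[mu]_y monomial y a = \int[nu]_y monomial y a.
  by move=> kn a ak; rewrite -mX -mY; exact: hM.1 ak.
under eq_fsbigr do rewrite mX mY.
have s00 : 0 < Num.min 1 (delta / 2) by rewrite lt_min ltr01 divr_gt0.
split.
  have [K K0 HK] := chi2_rate d0 d40 smu snu match_m.
  exact: cvg_of_inv_sqrt_rate s00 K0 HK.
have [K K0 HK] := KL_rate d0 d40 smu snu (ltn0Sn n) match_m.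
exact: cvg_of_inv_sqrt_rate s00 K0 HK.
Qed.
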